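(* Let $\Omega\subset\mathbb{R}^N$, $N\ge1$, be a domain satisfying Assumption $\mathcal{A}$ (stated in the context). Let $a,b,c,k>0$, $q>p>m>1$ and $2p<m+q$, and let $g$ satisfy $0\le g(\xi)\le k\,\xi^{p-m+1}$ for all $\xi\ge0$. Let $u_0\in C^{2+\alpha}(\Omega)\cap C^1(\overline{\Omega})$, for some $0<\alpha<1$, be positive and satisfy $\nabla u_0\cdot\boldsymbol{\nu}=g(u_0)$ on $\partial\Omega$. Suppose that $u$ is a classical solution (in the sense given in the context) of $$\begin{cases} u_t=\Delta u^m+a\int_\Omega u^p-b\,u^q-c\,|\nabla\sqrt{u}|^2 & \text{in }\Omega\times I,\\ \nabla u\cdot\boldsymbol{\nu}=g(u) & \text{on }\partial\Omega\times I,\\ u(\mathbf{x},0)=u_0(\mathbf{x}) & \mathbf{x}\in\Omega, \end{cases}$$ with $I=[0,t^* )$ its maximal interval of existence. Then $t^*=\infty$, or equivalently $I=[0,\infty)$.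
   Context: Assumption $\mathcal{A}$: for $N\ge1$, $\Omega$ is a bounded and smooth domain of $\mathbb{R}^N$, star-shaped and convex in two orthogonal directions, and for some origin $\mathbf{x}_0$ inside $\Omega$ its geometry is characterized by $\rho_0:=\min_{\partial\Omega}\big((\mathbf{x}-\mathbf{x}_0)\cdot\boldsymbol{\nu}\big)>0$ and $d:=\max_{\overline\Omega}|\mathbf{x}-\mathbf{x}_0|$, where $\boldsymbol{\nu}$ is the outward unit normal to $\partial\Omega$. Standing assumption: $g=g(\xi)\ge0$ is a sufficiently smooth function of $\xi\ge0$. Classical solution: for some $0<t^*\le+\infty$, a positive function $u\in C^{2,1}(\Omega\times(0,t^* ))\cap C^{1,0}(\overline{\Omega}\times[0,t^* ))$ which satisfies the initial boundary value problem. The nonlocal term is $\int_\Omega u^p=\int_\Omega u(\mathbf{x},t)^p\,d\mathbf{x}$. Maximal interval of existence $I=[0,t^* )$ (extensibility criterion): either $t^*=+\infty$, so that $u$ remains bounded for all $\mathbf{x}\in\Omega$ and all time $t>0$, or $t^*$ is finite (blow-up time), $u$ exists only on $[0,t^* )$ and $\|u(\cdot,t)\|_{L^\infty(\Omega)}\to+\infty$ as $t\to t^*$ from the left. *)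

(* Defs.v *)
From HB Require Import structures.
From mathcomp Require Import all_boot all_order all_algebra.
From mathcomp Require Import all_classical all_reals all_analysis.

Set Implicit Arguments.
Unset Strict Implicit.
Unset Printing Implicit Defensive.

Import Order.TTheory GRing.Theory Num.Theory.
Import numFieldNormedType.Exports.

Local Open Scope classical_set_scope.
Local Open Scope ring_scope.

(** * Lebesgue measure on ['rV[R]_n]

    The sigma-algebra is the one generated by the coordinate projections (as
    for [n.-tuple T] in the library); on R^n it is the Borel sigma-algebra. *)

Definition rV_display : measure_display.
Proof. exact: default_measure_display. Qed.

Section measurable_rV.
Context {R : realType} (n : nat).

Let coors : 'I_n -> 'rV[R]_n -> measurableTypeR R := fun i v => v ord0 i.

Let rV_set0 : g_sigma_preimage coors set0.
Proof. exact: sigma_algebra0. Qed.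

Let rV_setC A : g_sigma_preimage coors A -> g_sigma_preimage coors (~` A).
Proof. exact: sigma_algebraC. Qed.

Let rV_bigcup (F : _^nat) : (forall i, g_sigma_preimage coors (F i)) ->
  g_sigma_preimage coors (\bigcup_i (F i)).
Proof. exact: sigma_algebra_bigcup. Qed.

HB.instance Definition _ := @isMeasurable.Build
  rV_display 'rV[R]_n (g_sigma_preimage coors) rV_set0 rV_setC rV_bigcup.
End measurable_rV.

Section lebesgue_measure_rV.
Context {R : realType}.

Definition cons_rV n (z : measurableTypeR R * 'rV[R]_n) : 'rV[R]_n.+1 :=
  row_mx (z.1)%:M z.2.

Lemma cons_rV0 n z : @cons_rV n z ord0 ord0 = z.1.
Proof.
rewrite /cons_rV mxE; case: splitP => // j _.
by rewrite [j]ord1 mxE eqxx mulr1n.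
Qed.

Lemma cons_rVS n z j : @cons_rV n z ord0 (lift ord0 j) = z.2 ord0 j.
Proof.
rewrite /cons_rV mxE; case: splitP => [k|k /= jk]; first by rewrite [k]ord1.
by congr (z.2 _ _); apply/val_inj; case: jk.
Qed.

Lemma measurable_coord n (i : 'I_n) :
  measurable_fun setT (fun v : 'rV[R]_n => v ord0 i : measurableTypeR R).
Proof.
move=> _ Y mY; rewrite setTI; apply: sub_sigma_algebra => /=.
rewrite -bigcup_seq/=; exists i => /=; first by rewrite mem_index_enum.
by exists Y => //; rewrite setTI.
Qed.

Lemma measurable_fun_rVP d (T : measurableType d) n (f : T -> 'rV[R]_n) :
  (forall i, measurable_fun setT (fun x => f x ord0 i : measurableTypeR R)) ->
  measurable_fun setT f.
Proof.
move=> mf _ A mA; rewrite setTI; move: A mA.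
have : g_sigma_preimage (fun i (x : T) => f x ord0 i : measurableTypeR R)
    `<=` measurable.
  apply: smallest_sub; first exact: sigma_algebra_measurable.
  rewrite -bigcup_seq/=; apply: bigcup_sub => i _ _ [B mB <-].
  exact: mf.
move=> h A mA; apply: h.
rewrite (_ : (fun _ => _) = fun i => (fun v : 'rV[R]_n => v ord0 i) \o f)//.
by rewrite g_sigma_preimage_comp; exists A => //; rewrite setTI.
Qed.

Lemma measurable_cons_rV n : measurable_fun setT (@cons_rV n).
Proof.
apply: measurable_fun_rVP => i; have [j ->|->] := unliftP ord0 i.
  under eq_fun do rewrite cons_rVS.
  apply: (measurableT_comp (measurable_coord j)); exact: measurable_snd.
by under eq_fun do rewrite cons_rV0; exact: measurable_fst.
Qed.

Section step.
Context n (m : {sigma_finite_measure set 'rV[R]_n -> \bar R}).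

Definition lebesgue_step : set 'rV[R]_n.+1 -> \bar R :=
  pushforward ((@lebesgue_measure R) \x m)%E (@cons_rV n).

HB.instance Definition _ := Measure.copy lebesgue_step
  (measure_function_pushforward__canonical__measure_function_Measure
     ((@lebesgue_measure R) \x m)%E (@measurable_cons_rV n)).

Let lebesgue_step_sigma_finite : sigma_finite setT lebesgue_step.
Proof.
have [A [TA ndA Aoo]] :=
  (sigma_finiteP _ _).1 (@sigma_finiteT _ _ R (@lebesgue_measure R)).
have [B [TB ndB Boo]] := (sigma_finiteP _ _).1 (sigma_finiteT m).
pose F k := A k `*` B k.
pose uncons (v : 'rV[R]_n.+1) : measurableTypeR R * 'rV[R]_n :=
  (v ord0 ord0, \row_j v ord0 (lift ord0 j)).
have unconsK z : uncons (cons_rV z) = z.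
  case: z => x y; rewrite /uncons cons_rV0; congr pair.
  by apply/rowP => j; rewrite mxE cons_rVS.
have muncons : measurable_fun setT uncons.
  apply: measurable_fun_pair; first exact: measurable_coord.
  apply: measurable_fun_rVP => j; under eq_fun do rewrite mxE.
  exact: measurable_coord.
exists (fun k => uncons @^-1` F k).
  apply/esym; rewrite -subTset => v _.
  have [i _ Ai] : (\bigcup_i A i) (uncons v).1 by rewrite -TA.
  have [j _ Bj] : (\bigcup_i B i) (uncons v).2 by rewrite -TB.
  exists (maxn i j) => //; split.
    by move: Ai; exact/subsetPset/ndA/leq_maxl.
  by move: Bj; exact/subsetPset/ndB/leq_maxr.
move=> k; have [mAk Ak] := Aoo k; have [mBk Bk] := Boo k; split.
  by rewrite -[X in measurable X]setTI; apply: muncons => //; exact: measurableX.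
rewrite /lebesgue_step /pushforward -comp_preimage.
rewrite (_ : _ \o _ = id); last by apply/funext => z; exact: unconsK.
by rewrite preimage_id product_measure1E// lte_mul_pinfty// ge0_fin_numE.
Qed.

HB.instance Definition _ := @Measure_isSigmaFinite.Build _ _ _
  lebesgue_step lebesgue_step_sigma_finite.
End step.

Fixpoint lebesgue_rV n : {sigma_finite_measure set 'rV[R]_n -> \bar R} :=
  if n is n'.+1 then lebesgue_step (lebesgue_rV n') else \d_(0 : 'rV[R]_0).

Lemma lebesgue_rV_box n (A : 'I_n -> set R) :
  (forall i, measurable (A i : set (measurableTypeR R))) ->
  lebesgue_rV n [set v | forall i, A i (v ord0 i)] =
  (\prod_(i < n) lebesgue_measure (A i))%E.
Proof.
elim: n A => [|n IHn] A mA /=.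
  by rewrite big_ord0 diracE mem_set// => -[].
rewrite big_ord_recl -IHn// /lebesgue_step /pushforward -product_measure1E//.
  congr (product_measure1 _ _ _); apply/seteqP; split=> [z /= Az|z /= [A0 AS] i].
    split; first by have := Az ord0; rewrite cons_rV0.
    by move=> i; have := Az (lift ord0 i); rewrite cons_rVS.
  by have [j ->|->] := unliftP ord0 i; rewrite ?cons_rV0// cons_rVS.
rewrite (_ : (fun _ => _) = \bigcap_(i in [set: 'I_n])
    ((fun v : 'rV[R]_n => v ord0 i) @^-1` A (lift ord0 i))); last first.
  by apply/seteqP; split=> v /= h i; [move=> _|]; exact: h.
apply: fin_bigcap_measurable => // i _.
by rewrite -[X in measurable X]setTI; exact: measurable_coord.
Qed.

End lebesgue_measure_rV.

(** * Calculus on ['rV[R]_N]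

    The norm [`|x|] of the library on ['rV[R]_N] is the sup norm; it gives the
    topology, but lengths and unit normals are Euclidean. *)

Section calculus.
Context {R : realType} {N : nat}.
Implicit Types (x y v : 'rV[R]_N) (W : set 'rV[R]_N) (f : 'rV[R]_N -> R).

Definition dot x y : R := \sum_i x ord0 i * y ord0 i.
Definition enorm x : R := Num.sqrt (dot x x).

Definition evec (i : 'I_N) : 'rV[R]_N := delta_mx ord0 i.
Definition partial (i : 'I_N) f x : R := 'D_(evec i) f x.
Definition grad f x : 'rV[R]_N := \row_i partial i f x.
Definition laplacian f x : R := \sum_i partial i (partial i f) x.

(* f is of class C^k on the open set W *)
Fixpoint class_C (k : nat) W f : Prop :=
  {within W, continuous f} /\
  (if k is k'.+1 then
     forall i, (forall x, W x -> derivable f x (evec i)) /\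
               class_C k' W (partial i f)
   else True).

Definition smooth W f : Prop := forall k, class_C k W f.

(* f is in C^1 of the closure of the open set W: the gradient in W has a
   continuous extension Df to the closure, whose values on the boundary are
   the meaning of "nabla f" there. *)
Definition C1_closure W f (Df : 'rV[R]_N -> 'rV[R]_N) : Prop :=
  [/\ {within closure W, continuous f},
      {within closure W, continuous Df} &
      forall x, W x -> forall i, is_derive x (evec i) f (Df x ord0 i)].

(* f is in C^(2+alpha) of the open set W: Hoelder continuity of the second
   derivatives is required locally (on compact subsets of W). *)
Definition C2_holder (alpha : R) W f : Prop :=
  class_C 2 W f /\
  forall i j K, compact K -> K `<=` W ->
    exists M : R, forall x y, K x -> K y ->
      `|partial j (partial i f) x - partial j (partial i f) y|
        <= M * enorm (x - y) `^ alpha.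

End calculus.

(** * Domains *)

Section domains.
Context {R : realType} {N : nat}.
Implicit Types (x y e : 'rV[R]_N) (Omega : set 'rV[R]_N).

Definition boundary Omega : set 'rV[R]_N := closure Omega `\` Omega°.

(* near x, Omega is the sublevel set [rho < 0] of a smooth function with
   nonvanishing gradient *)
Definition local_defining_function Omega x (rho : 'rV[R]_N -> R) : Prop :=
  exists W : set 'rV[R]_N,
    [/\ open W, W x, smooth W rho,
        forall y, W y -> (Omega y <-> rho y < 0) &
        forall y, W y -> grad rho y != 0].

Definition smooth_boundary Omega : Prop :=
  forall x, boundary Omega x -> exists rho, local_defining_function Omega x rho.

(* rho < 0 inside and rho > 0 outside, so the gradient points outwards *)
Definition outward_unit_normal Omega x (nu : 'rV[R]_N) : Prop :=
  exists2 rho, local_defining_function Omega x rho &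
    nu = (enorm (grad rho x))^-1 *: grad rho x.

Definition star_shaped Omega : Prop :=
  exists2 y, Omega y &
    forall x l, Omega x -> 0 <= l <= 1 -> Omega (y + l *: (x - y)).

(* every line with direction e meets Omega in a connected set *)
Definition convex_in_direction Omega e : Prop :=
  forall x s l, Omega x -> Omega (x + s *: e) -> 0 <= l <= 1 ->
    Omega (x + (l * s) *: e).

Definition is_min (S : set R) r : Prop := S r /\ lbound S r.
Definition is_max (S : set R) r : Prop := S r /\ ubound S r.

(* In dimension 1 there are no two orthogonal directions, and the directional
   convexity is void (the domain is an interval). *)
Definition assumption_A Omega : Prop :=
  [/\ [/\ open Omega, connected Omega, bounded_set Omega & smooth_boundary Omega],
      star_shaped Omega,
      (2 <= N)%N -> exists e1 e2,
        [/\ e1 != 0, e2 != 0, dot e1 e2 = 0,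
            convex_in_direction Omega e1 & convex_in_direction Omega e2] &
      exists x0 rho0 d,
        [/\ Omega x0,
            is_min [set r | exists x nu, [/\ boundary Omega x,
               outward_unit_normal Omega x nu & r = dot (x - x0) nu]] rho0,
            0 < rho0 &
            is_max [set enorm (x - x0) | x in closure Omega] d]].

End domains.

(** * The initial boundary value problem

    [u x t] is the value of u at the point x and time t; the final time
    [T : \bar R] may be [+oo]. *)

Section problem.
Context {R : realType} {N : nat}.
Implicit Types (Omega : set 'rV[R]_N) (T : \bar R) (u : 'rV[R]_N -> R -> R).

(* g is of class C^1 on [0, +oo[ *)
Definition C1_halfline (g : R -> R) : Prop :=
  {within `[0, +oo[, continuous g} /\
  exists2 g' : R -> R, {within `[0, +oo[, continuous g'} &
    forall xi : R, 0 < xi -> is_derive xi 1 g (g' xi).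

(* C^{2,1}(Omega x ]0, T[) *)
Definition C21 Omega T u : Prop :=
  let Q := Omega `*` [set t : R | 0 < t /\ (t%:E < T)%E] in
  [/\ {within Q, continuous (fun z => u z.1 z.2)},
      (forall x (t : R), Q (x, t) -> derivable (u x) t 1) /\
        {within Q, continuous (fun z => derive1 (u z.1) z.2)},
      forall i, (forall x (t : R), Q (x, t) -> derivable (u ^~ t) x (evec i)) /\
        {within Q, continuous (fun z => partial i (u ^~ z.2) z.1)} &
      forall i j,
        (forall x (t : R), Q (x, t) ->
           derivable (partial i (u ^~ t)) x (evec j)) /\
        {within Q, continuous
           (fun z => partial j (partial i (u ^~ z.2)) z.1)}].

(* C^{1,0}(closure Omega x [0, T[); as in [C1_closure], Du is the continuous
   extension of the spatial gradient up to the boundary *)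
Definition C10_closure Omega T u (Du : 'rV[R]_N -> R -> 'rV[R]_N) : Prop :=
  let Q := closure Omega `*` [set t : R | 0 <= t /\ (t%:E < T)%E] in
  [/\ {within Q, continuous (fun z => u z.1 z.2)},
      {within Q, continuous (fun z => Du z.1 z.2)} &
      forall x (t : R), Omega x -> 0 <= t -> (t%:E < T)%E ->
        forall i, is_derive x (evec i) (u ^~ t) (Du x t ord0 i)].

(* The equation is required for t > 0, where C^{2,1} makes sense; the boundary
   condition holds from t = 0 on, up to which C^{1,0} extends. *)
Definition classical_solution Omega (a b c m p q : R) (g : R -> R)
    (u0 : 'rV[R]_N -> R) T u : Prop :=
  [/\ (0 < T)%E,
      forall x (t : R), Omega x -> 0 <= t -> (t%:E < T)%E -> 0 < u x t,
      C21 Omega T u,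
      forall x (t : R), Omega x -> 0 < t -> (t%:E < T)%E ->
        derive1 (u x) t =
          laplacian (fun y => u y t `^ m) x
          + a * \int[lebesgue_rV N]_(y in Omega) (u y t `^ p)
          - b * u x t `^ q
          - c * enorm (grad (fun y => Num.sqrt (u y t)) x) ^+ 2 &
      (exists2 Du, C10_closure Omega T u Du &
         forall x nu (t : R), boundary Omega x -> outward_unit_normal Omega x nu ->
           0 <= t -> (t%:E < T)%E -> dot (Du x t) nu = g (u x t)) /\
      (forall x, Omega x -> u x 0 = u0 x)].

Definition Linfty_norm Omega (f : 'rV[R]_N -> R) : \bar R :=
  'N[lebesgue_rV N]_+oo [(fun x => (f x)%:E) \_ Omega].

(* [0, T[ is the maximal interval of existence of u, in the form of the
   extensibility criterion: the solution is global, or the sup norm blows up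
   at the finite time T. *)
Definition maximal_time Omega T u : Prop :=
  T = +oo%E \/
  exists2 t0 : R, T = t0%:E &
    Linfty_norm Omega (u ^~ t) @[t --> t0^'-] --> +oo%E.

End problem.

(* Main.v *)
Require Import Defs.
From mathcomp Require Import all_boot all_order all_algebra.
From mathcomp Require Import all_classical all_reals all_analysis.
From mathcomp Require Import measurable_realfun ess_sup_inf.
From mathcomp Require Import ring lra.

Import Order.TTheory GRing.Theory Num.Theory.
Import numFieldNormedType.Exports.
Import HBNNSimple.

Local Open Scope classical_set_scope.
Local Open Scope ring_scope.

(** The solution stays below a bound that does not depend on time, so the
    blow-up alternative of the extensibility criterion is impossible. The bound
    comes from the parabolic maximum principle, applied to a stationary barrier
    with a boundary layer.

    Put [gam = p - m > 0] and write barriers as [F `^ (- gam^-1)], so that a small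
    [F], of size [e], is a barrier of size [e `^ (- gam^-1)]. In this variable the
    boundary condition [du/dnu <= k u^(gam + 1)] loses its nonlinearity: the
    normal derivative of the barrier exceeds the one allowed for the solution
    as soon as [dF/dnu < - k gam], a constant. So [F] must drop by a fixed slope towards the boundary, although its values are
    only of size [e]; this forces a layer of width [e] and second derivatives of
    size [1 / e]. Near a boundary point [z], where [Omega] is [rho < 0], this is
    achieved by
      [F = e * (9/4 - |x - z|^2 / r^2 - exp (A rho / e) / 4)]
    ([layer], [layer_exists]).

    The diffusion term of such a barrier is at most of order
    [e `^ (- (m / gam + 2))], the nonlocal term of order [e `^ (- (p / gam))], and
    the absorption [b u^q] of order [e `^ (- (q / gam))]. The hypotheses
    [2 p < m + q] and [p < q] say exactly that the absorption dominates for small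
    [e] ([powRN_dominates]), and the gradient term has the favourable sign.

    Finitely many of these layers, each confined to a ball around a boundary
    point, are used together with the constant [F = 3/2 e] ([finite_layers]). The
    cut-off [|x - z|^2 / r^2] makes each layer active only well inside its ball,
    and makes the constant inactive on the boundary, so that no gluing is needed.
    At the first time at which the solution touches a barrier
    ([first_contact]), the contact point is either in [Omega], where the second
    derivatives along the axes contradict the equation
    ([laplacian_contact_le]), or on the boundary, where the slope of the barrier
    contradicts the boundary condition ([boundary_contact_absurd]). Hence there
    is no contact ([sup_bound]). *)

(** * Derivatives along lines *)

(** Reduces derivatives in a direction to derivatives of functions of one real
    variable, for which the mean value theorem and the chain rule hold. *)
Lemma is_derive_line {R : numFieldType} {V : normedModType R} (f : V -> R)
    (x v : V) (s d : R) :
  is_derive (x + s *: v) v f d <-> is_derive s 1 (fun h => f (x + h *: v)) d.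
Proof.
have E : (fun h : R => h^-1 *: ((f \o shift (x + s *: v)) (h *: v)
             - f (x + s *: v))) =
         (fun h => h^-1 *: (((fun h => f (x + h *: v)) \o shift s) (h *: 1)
             - f (x + s *: v))).
  apply/funext => h /=; rewrite scalerDl [_%:A]mulr1.
  by congr (_ *: (f _ - _)); rewrite addrCA.
split=> -[]; rewrite /derivable /derive.
  by rewrite E => H1 H2; apply: DeriveDef.
by rewrite -E => H1 H2; apply: DeriveDef.
Qed.

(** If the second derivative were negative, then, the first derivative being zero
    at the minimum, it would be negative to the right of it, and the mean value
    theorem would give smaller values there. Only one derivative near the
    point, and the second one at the point, are available. *)
Lemma second_derivative_test {R : realType} (f f' : R -> R) (s l : R) :
  (\forall t \near s, is_derive (t : R) 1 f (f' t)) -> is_derive s 1 f' l ->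
  (\forall t \near s, f s <= f t) -> 0 <= l.
Proof.
move=> fd f'd fmin.
have f's : f' s = 0.
  move: fd fmin => /nbhs_ballP[e1 /= e10 fd] /nbhs_ballP[e2 /= e20 fmin].
  pose e := Num.min e1 e2.
  have e0 : 0 < e by rewrite /e lt_min e10.
  have sub t : t \in `]s - e, s + e[ -> `|s - t| < e1 /\ `|s - t| < e2.
    rewrite in_itv/= => /andP[h1 h2].
    have : `|s - t| < e by rewrite ltr_norml; apply/andP; split; lra.
    by rewrite lt_min => /andP.
  have : is_derive s 1 f 0.
    apply: (@derive1_at_min R f (s - e) (s + e)).
    - by lra.
    - by move=> t /sub[h _]; exact: (@ex_derive _ _ _ _ _ _ _ (fd t h)).
    - by rewrite in_itv/=; apply/andP; split; lra.
    - by move=> t /sub[_ h]; apply: fmin.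
  move=> [_ <-]; have [_ <-] : is_derive s 1 f (f' s) by apply: fd; exact: ballxx.
  by [].
rewrite leNgt; apply/negP => l0.
have nder : \forall h \near 0^', h^-1 * f' (h + s) < 0.
  have : (h^-1 * f' (h + s)) @[h --> 0^'] --> l.
    have [d1 d2] := f'd.
    rewrite -d2; apply: cvg_trans d1; apply: near_eq_cvg; near=> h.
    by rewrite /= f's subr0 [_%:A]mulr1.
  by move/cvgr_lt; apply.
have fneg : \forall t \near s, s < t -> f' t < 0.
  move: nder => /nbhs_ballP[e /= e0 nder]; apply/nbhs_ballP; exists e => //= t st.
  move=> sltt; have := nder (t - s); rewrite /ball/= sub0r opprB.
  move=> /(_ st); rewrite subr_eq0 gt_eqF// => /(_ isT).
  by rewrite subrK pmulr_rlt0 ?invr_gt0 ?subr_gt0.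
move: fneg fd fmin => /nbhs_ballP[e0 /= e00 fneg] /nbhs_ballP[e1 /= e10 fd]
  /nbhs_ballP[e2 /= e20 fmin].
pose e := Num.min e0 (Num.min e1 e2).
have ep : 0 < e by rewrite /e !lt_min e00 e10.
have sub t : t \in `[s, s + e / 2] -> [/\ `|s - t| < e0, `|s - t| < e1 & `|s - t| < e2].
  rewrite in_itv/= => /andP[h1 h2].
  have : `|s - t| < e by rewrite ltr_norml; apply/andP; split; lra.
  by rewrite !lt_min => /andP[? /andP[]].
have [|t|t|c cI] := @MVT R f f' s (s + e / 2).
- lra.
- move=> tI; have [|_ h _] := sub t; last exact: fd.
  by move: tI; rewrite !in_itv/= => /andP[h1 h2]; apply/andP; split; lra.
- apply: derivable_within_continuous => y /sub[_ h _].
  exact: (@ex_derive _ _ _ _ _ _ _ (fd y h)).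
have [|h1 _ h3] := sub c.
  by move: cI; rewrite !in_itv/= => /andP[h1 h2]; apply/andP; split; lra.
have := fneg c h1.
have /fmin : ball s e2 (s + e / 2).
  have [] // := sub (s + e / 2).
  by rewrite in_itv/=; apply/andP; split; lra.
move: cI; rewrite in_itv/= => /andP[sc _] h4 /(_ sc) h5 h6.
suff : f' c * (s + e / 2 - s) < 0 by lra.
by rewrite pmulr_llt0//; lra.
Unshelve. all: by end_near. Qed.

Lemma is_derive_line0 {R : numFieldType} {V : normedModType R} (f : V -> R)
    (x v : V) (d : R) :
  is_derive x v f d <-> is_derive (0 : R) 1 (fun h => f (x + h *: v)) d.
Proof. by rewrite -is_derive_line scale0r addr0. Qed.

Lemma near_line {R : numFieldType} {V : normedModType R} (x v : V)
    (P : V -> Prop) :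
  (\forall y \near x, P y) -> \forall t \near (0 : R), P (x + t *: v).
Proof.
move=> nP; have : x + t *: v @[t --> (0 : R)] --> x.
  have h := @scalel_continuous _ _ v (0 : R).
  by have := cvgD (cvg_cst x) h; rewrite scale0r addr0; apply.
by move=> /(_ _ nP).
Qed.

Lemma second_derivative_test_dir {R : realType} {V : normedModType R}
    (f f' : V -> R) (x v : V) (l : R) :
  (\forall y \near x, is_derive y v f (f' y)) -> is_derive x v f' l ->
  (\forall y \near x, f x <= f y) -> 0 <= l.
Proof.
move=> fd f'd fmin.
apply: (@second_derivative_test R (fun t => f (x + t *: v))
  (fun t => f' (x + t *: v)) 0 l).
- by near=> t; apply/is_derive_line; near: t; exact: near_line fd.
- by move/is_derive_line0: f'd.
- by near=> t; rewrite scale0r addr0; near: t; exact: near_line fmin.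
Unshelve. all: by end_near. Qed.

Lemma is_derive_comp_dir {R : realType} {V : normedModType R} (g : R -> R)
    (f : V -> R) (x v : V) (a d : R) :
  is_derive (f x) 1 g a -> is_derive x v f d ->
  is_derive x v (fun y => g (f y)) (a * d).
Proof.
move=> ga /is_derive_line0 fd; apply/is_derive_line0.
apply: (@is_derive1_comp _ g (fun h => f (x + h *: v))) => //.
by rewrite scale0r addr0.
Qed.

Lemma is_derive_powR_comp {R : realType} {V : normedModType R} (f : V -> R)
    (x v : V) (r d : R) :
  0 < f x -> is_derive x v f d ->
  is_derive x v (fun y => f y `^ r) (r * f x `^ (r - 1) * d).
Proof.
move=> fx; apply: (is_derive_comp_dir (fun a => a `^ r)).
exact: is_derive1_powR.
Qed.

Lemma is_derive_powR_comp2 {R : realType} {V : normedModType R}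
    (f f' : V -> R) (x v : V) (r d : R) :
  0 < f x -> is_derive x v f (f' x) -> is_derive x v f' d ->
  is_derive x v (fun y => r * f y `^ (r - 1) * f' y)
    (r * (r - 1) * f x `^ (r - 2) * f' x ^+ 2 + r * f x `^ (r - 1) * d).
Proof.
move=> fx fd f'd.
have h1 := is_derive_powR_comp f x v (r - 1) _ fx fd.
have h2 := is_deriveZ (r : R) h1.
have h3 := is_deriveM h2 f'd.
apply: (@is_derive_eq _ _ _ _ _ _ _ _ h3).
rewrite /= /GRing.scale/= /GRing.scale/=.
have -> : r - 1 - 1 = r - 2 by ring.
ring.
Qed.

Section directional.
Context {R : realType} {N : nat}.
Implicit Types (f : 'rV[R]_N -> R) (x v w : 'rV[R]_N).

Lemma MVT_abs (f df : R -> R) (t : R) :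
  (forall s, `|s| <= `|t| -> is_derive (s : R) 1 f (df s)) ->
  exists2 s, `|s| <= `|t| & f t - f 0 = df s * t.
Proof.
move=> fd; have [t0|t0|->] := ltgtP t 0.
- have [||s] := @MVT R f df t 0 t0.
  + by move=> s; rewrite in_itv/= => /andP[h1 h2]; apply: fd; rewrite !ltr0_norm//; lra.
  + apply: derivable_within_continuous => s; rewrite in_itv/= => /andP[h1 h2].
    suff /fd [] : `|s| <= `|t| by [].
    by rewrite ler0_norm// ltr0_norm//; lra.
  + rewrite in_itv/= => /andP[h1 h2] E; exists s; first by rewrite !ltr0_norm//; lra.
    by rewrite -[LHS]opprB E; ring.
- have [||s] := @MVT R f df 0 t t0.
  + by move=> s; rewrite in_itv/= => /andP[h1 h2]; apply: fd; rewrite !gtr0_norm//; lra.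
  + apply: derivable_within_continuous => s; rewrite in_itv/= => /andP[h1 h2].
    suff /fd [] : `|s| <= `|t| by [].
    by rewrite ger0_norm// gtr0_norm//; lra.
  + rewrite in_itv/= => /andP[h1 h2] E; exists s; first by rewrite !gtr0_norm//; lra.
    by rewrite E subr0.
- by exists 0; rewrite ?subrr ?mulr0.
Qed.

(** The increment along [v + c w] splits into one along [v] from [x], and one along
    [w] from a nearby point. The mean value theorem turns the latter into a value
    of [dw] close to [x]. *)
Lemma is_derive_addv {V : normedModType R} (f : V -> R) (x v w : V) (a c : R)
    (dw : V -> R) :
  is_derive x v f a ->
  (\forall y \near x, is_derive y w f (dw y)) ->
  dw @ x --> dw x ->
  is_derive x (v + c *: w) f (a + c * dw x).
Proof.
move=> [fv <-] fw dwx.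
suff H : (fun h => h^-1 *: ((f \o shift x) (h *: (v + c *: w)) - f x)) @ 0^' -->
    'D_v f x + c * dw x.
  by apply: DeriveDef; [apply/cvg_ex; eexists; exact: H|exact/cvg_lim].
pose r (h : R) : R := h^-1 *: (f (h *: v + (h * c) *: w + x) - f (h *: v + x)).
have -> : (fun h => h^-1 *: ((f \o shift x) (h *: (v + c *: w)) - f x)) =
   (fun h => h^-1 *: ((f \o shift x) (h *: v) - f x)) + r.
  apply/funext => h; rewrite /r /= [RHS]/GRing.add/= [h *: (v + _)]scalerDr scalerA -scalerDr.
  by congr (_ *: _); ring.
apply: cvgD; first exact: fv.
have : (c * dw y) @[y --> x] --> c * dw x by apply: cvgMl_tmp; exact: dwx.
move=> /cvgrPdist_lt cd; apply/cvgrPdist_lt => e e0.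
have : nbhs x [set y | is_derive y w f (dw y) /\ `|c * dw x - c * dw y| < e].
  exact: (filterI fw (cd e e0)).
move=> /nbhs_ballP[d /= d0 H].
near=> h.
have hd : `|h| * (`|v| + `|c| * `|w|) < d.
  have B0 : 0 < `|v| + `|c| * `|w| + 1.
    by rewrite ltr_wpDl// addr_ge0// mulr_ge0.
  apply: (@le_lt_trans _ _ (`|h| * (`|v| + `|c| * `|w| + 1))).
    by rewrite ler_wpM2l// lerDl.
  rewrite -ltr_pdivlMr//; near: h; apply: dnbhs0_lt; exact: divr_gt0.
have h0 : h != 0 by near: h; exact: nbhs_dnbhs_neq.
have near_x s : `|s| <= `|h * c| -> ball x d (x + h *: v + s *: w).
  move=> sh; rewrite -ball_normE /ball_/= !opprD !addrA subrr sub0r.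
  rewrite -opprD normrN; apply: le_lt_trans (ler_normD _ _) _.
  apply: le_lt_trans hd; rewrite !normrZ mulrDr lerD2l mulrA -normrM.
  exact: ler_wpM2r.
have [|s sh E] := @MVT_abs (fun s => f (x + h *: v + s *: w))
   (fun s => dw (x + h *: v + s *: w)) (h * c).
  by move=> s /near_x/H[+ _] => /is_derive_line.
have [_ Hs] := H _ (near_x _ sh).
rewrite /r (addrC _ x) addrA (addrC _ x).
move: E; rewrite scale0r addr0 => ->.
have -> : h^-1 *: (dw (x + h *: v + s *: w) * (h * c)) = c * dw (x + h *: v + s *: w).
  by rewrite /GRing.scale/=; field.
exact: Hs.
Unshelve. all: by end_near. Qed.

(** Continuous partial derivatives give all directional derivatives: the axes are
    added one at a time. *)
Lemma is_derive_dir (W : set 'rV[R]_N) f (Df : 'rV[R]_N -> 'rV[R]_N) x v :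
  open W -> W x ->
  (forall y, W y -> forall i, is_derive y (evec i) f (Df y ord0 i)) ->
  (forall i, continuous_at x (fun y => Df y ord0 i)) ->
  is_derive x v f (dot (Df x) v).
Proof.
move=> oW Wx fD cDf.
have nW : \forall y \near x, W y by exact: open_nbhs_nbhs.
have H (s : seq 'I_N) : is_derive x (\sum_(i <- s) v ord0 i *: evec i) f
    (\sum_(i <- s) v ord0 i * Df x ord0 i).
  elim: s => [|i s IH]; first by rewrite !big_nil; exact: is_derive0.
  rewrite !big_cons addrC [X in is_derive _ _ _ X]addrC.
  apply: (is_derive_addv f x _ _ _ _ (fun y => Df y ord0 i)) => //.
    by near=> y; apply: fD; near: y.
  exact: cDf.
have := H (index_enum 'I_N).
rewrite -row_sum_delta; suff -> : \sum_i v ord0 i * Df x ord0 i = dot (Df x) v by [].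
by apply: eq_bigr => i _; rewrite mulrC.
Unshelve. all: by end_near. Qed.

End directional.

Lemma derive_gt0_left {R : realType} (phi : R -> R) (D : R) : is_derive (0 : R) 1 phi D -> 0 < D ->
  \forall s \near 0^'+, phi (- s) < phi 0.
Proof.
move=> [d1 d2] D0.
have : \forall h \near 0^', 0 < h^-1 * (phi h - phi 0).
  have : h^-1 * (phi h - phi 0) @[h --> 0^'] --> D.
    rewrite -d2; apply: cvg_trans d1; apply: near_eq_cvg; near=> h.
    by rewrite /= [_%:A]mulr1 addr0.
  by move/cvgr_gt; apply.
move=> /nbhs_ballP[e /= e0 H]; exists e => //= s.
rewrite /ball/= sub0r normrN => se s0.
have := H (- s); rewrite /ball/= sub0r opprK => /(_ se).
by rewrite oppr_eq0 gt_eqF// => /(_ isT); rewrite nmulr_rgt0 ?invr_lt0 ?oppr_lt0// subr_lt0.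
Unshelve. all: by end_near. Qed.

(** The time derivative at the first contact: only earlier times are compared. *)
Lemma derive1_ge0_left {R : realType} (f : R -> R) (t : R) : 0 < t ->
  derivable f t 1 -> (forall s, 0 <= s < t -> f s <= f t) -> 0 <= derive1 f t.
Proof.
move=> t0 df fmax; rewrite leNgt; apply/negP => d0.
have h : is_derive (0 : R) 1 (fun h => - f (t + h *: 1)) (- derive1 f t).
  have h0 : is_derive (0 : R) 1 (fun h => f (t + h *: 1)) (derive1 f t).
    by apply/(is_derive_line0 f t 1); rewrite derive1E; exact: DeriveDef.
  exact: (is_deriveN h0).
have := derive_gt0_left _ _ h; rewrite oppr_gt0 => /(_ d0) H.
have [s [s0 [st]]] : exists s : R, 0 < s /\ s < t /\ - f (t + (- s) *: 1) < - f (t + 0 *: 1).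
  have : \forall s \near 0^'+, 0 < s /\ s < t /\ - f (t + (- s) *: 1) < - f (t + 0 *: 1).
    near=> s; split; first by near: s; exact: nbhs_right_gt.
    by split; near: s; [exact: nbhs_right_lt|exact: H].
  by move=> /filter_ex.
rewrite ltrN2 scale0r addr0 ltNge [_%:A]mulr1; apply/negP/negPn.
by apply: fmax; rewrite subr_ge0 (ltW st)/= ltrBlDr ltrDl.
Unshelve. all: by end_near. Qed.

(** * Continuity, compactness and filters *)

Section continuous_at_ops.
Context {R : realType} {T : topologicalType} (x : T).
Implicit Types f g : T -> R.

Lemma continuous_at_cst (a : R) : continuous_at x (fun=> a).
Proof. exact: cvg_cst. Qed.

Lemma continuous_atB f g : continuous_at x f -> continuous_at x g ->
  continuous_at x (fun y => f y - g y).
Proof. by move=> cf cg; apply: cvgB. Qed.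

Lemma continuous_atN f : continuous_at x f -> continuous_at x (fun y => - f y).
Proof. by move=> cf; apply: cvgN. Qed.

Lemma continuous_atM f g : continuous_at x f -> continuous_at x g ->
  continuous_at x (fun y => f y * g y).
Proof. by move=> cf cg; apply: cvgM. Qed.

Lemma continuous_at_expR f : continuous_at x f ->
  continuous_at x (fun y => expR (f y)).
Proof. by move=> cf; apply: (continuous_comp cf); exact: continuous_expR. Qed.
End continuous_at_ops.

Lemma continuous_within_comp {S T U : topologicalType} (A : set T) (B : set S)
    (g : S -> T) (f : T -> U) :
  {within A, continuous f} -> continuous g -> (forall s, B s -> A (g s)) ->
  {within B, continuous (fun s => f (g s))}.
Proof.
move=> /subspace_continuousP cf cg BA; apply/subspace_continuousP => s Bs.
have cfs := cf _ (BA s Bs).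
move=> P /cfs nP.
have h := cg s _ nP.
exact: (@filterS _ (nbhs s) _ _ _ (fun s' H Bs' => H (BA s' Bs')) h).
Qed.

Lemma near_seq {I : eqType} {S : Type} (F : set_system S) {FF : Filter F}
    (D : seq I) (P : I -> S -> Prop) :
  (forall i, i \in D -> \forall s \near F, P i s) ->
  \forall s \near F, forall i, i \in D -> P i s.
Proof.
elim: D => [|j D IH] HP; first by apply: nearW => s i; rewrite in_nil.
have h1 := HP j (mem_head _ _).
have h2 : \forall s \near F, forall i, i \in D -> P i s.
  by apply: IH => i iD; apply: HP; rewrite inE iD orbT.
near=> s => i; rewrite inE => /predU1P[->|]; first by near: s.
by move: i; near: s.
Unshelve. all: by end_near. Qed.

Lemma continuous_pairr {S T : topologicalType} (t : T) :
  continuous (fun s : S => (s, t)).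
Proof. by move=> s; apply: cvg_pair => //=; exact: cvg_cst. Qed.

Lemma compact_within_ge0 {R : realType} {T : topologicalType} (A : set T) (f : T -> R) :
  compact A -> {within A, continuous f} -> compact (A `&` [set x | 0 <= f x]).
Proof.
move=> cA cf.
have : closed ((f : subspace A -> R) @^-1` [set y | 0 <= y]).
  by apply: closed_comp; [move=> x _; exact: cf|exact: closed_ge].
move=> /closed_subspaceP[V cV VA].
rewrite setIC (_ : _ `&` A = A `&` V); first exact: compact_closedI.
by rewrite [RHS]setIC VA.
Qed.

Lemma within_pos_near {R : realType} {V : normedModType R} (A : set V) (f : V -> R) (x : V) :
  {within A, continuous f} -> A x -> 0 < f x ->
  exists2 e : R, 0 < e & forall y, A y -> ball x e y -> 0 < f y.
Proof.
move=> /subspace_continuousP cf Ax fx.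
have /cvgr_gt /(_ 0 fx) := cf x Ax.
by move=> /nbhs_ballP[e /= e0 H]; exists e => // y Ay xy; exact: H.
Qed.

(** The pairs (point, time) at which some [f i] is nonnegative form a compact set,
    and [t] is the least time in it. Continuity in
    time from the left then gives [f j <= 0] at the time [t] itself. *)
Lemma first_contact {R : realType} {V : normedModType R} (I : choiceType)
    (s : seq I) (K : I -> set V) (f : I -> V -> R -> R) (T : R) :
  (forall i, i \in s -> compact (K i)) ->
  (forall i, i \in s ->
     {within K i `*` [set` `[0, T]], continuous (fun z => f i z.1 z.2)}) ->
  (forall i x, i \in s -> K i x -> f i x 0 < 0) ->
  (exists i x t, [/\ i \in s, K i x, 0 <= t <= T & 0 <= f i x t]) ->
  exists i x t, [/\ i \in s, K i x, 0 < t <= T, f i x t = 0 &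
    forall j y, j \in s -> K j y -> f j y t <= 0 /\
      forall r, 0 <= r < t -> f j y r < 0].
Proof.
move=> cK cf f0 [i0 [x0 [t0 [i0s Kx0 t0T fx0]]]].
pose A i := K i `*` [set` `[0, T]] : set (V * R).
pose C i := A i `&` [set z | 0 <= f i z.1 z.2].
have cC i : i \in s -> compact (C i).
  move=> si; apply: compact_within_ge0; last exact: cf.
  by apply: compact_setX; [exact: cK|exact: segment_compact].
have cU : compact (\bigcup_(i in [set` s]) C i).
  rewrite bigcup_seq big_seq; elim/big_ind : _ => //; first exact: compact0.
  exact: compactU.
have [||z] := @compact_EVT_min (V * R)%type R snd _ _ cU.
- exists (x0, t0); exists i0 => //; split => //; split => //=.
- by apply: continuous_subspaceT => z; exact: cvg_snd.
rewrite inE => -[i /= si [[Kiz /= tz] fz]] zmin.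
have neg j y r : j \in s -> K j y -> 0 <= r < z.2 -> f j y r < 0.
  move=> sj Ky /andP[r0 rz]; rewrite ltNge; apply/negP => fr.
  have : (y, r) \in \bigcup_(i in [set` s]) C i.
    rewrite inE; exists j => //; split => //; split => //=.
    by rewrite in_itv/= r0; move: tz; rewrite in_itv/= => /andP[_]; lra.
  by move=> /zmin/=; rewrite leNgt rz.
move: tz; rewrite in_itv/= => /andP[z0 zT].
have {}z0 : 0 < z.2.
  rewrite lt_neqAle z0 andbT; apply/negP => /eqP z20.
  by move: fz => /=; rewrite -z20 leNgt f0.
have le0 j y : j \in s -> K j y -> f j y z.2 <= 0.
  move=> sj Ky; rewrite leNgt; apply/negP => fp.
  have Ayz : A j (y, z.2) by split => //=; rewrite in_itv/= (ltW z0).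
  have [e e0 H] := within_pos_near _ _ _ (cf j sj) Ayz fp.
  pose r := Num.max 0 (z.2 - e / 2).
  have r0z : 0 <= r < z.2 by rewrite /r le_max lexx gt_max z0/=; lra.
  have := neg _ _ _ sj Ky r0z; apply/negP; rewrite -leNgt; apply: ltW.
  apply: (H (y, r)).
    by split => //=; rewrite in_itv/=; lra.
  split => /=; first exact: ballxx.
  rewrite /ball/= ger0_norm; last by lra.
  have : z.2 - e / 2 <= r by rewrite /r le_max lexx orbT.
  lra.
exists i, z.1, z.2; split => //.
- by rewrite z0.
- by apply: le_anti; rewrite fz le0.
- by move=> j y sj Ky; split; [exact: le0|move=> r; exact: neg].
Qed.

(** * Real powers *)

Section powR_neg.
Context {R : realType}.
Implicit Types a b s r : R.

Lemma powRN_le a b s : 0 < a -> a <= b -> 0 <= s -> b `^ (- s) <= a `^ (- s).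
Proof.
move=> a0 ab s0; have b0 := lt_le_trans a0 ab.
rewrite !powRN lef_pV2 ?posrE ?powR_gt0//.
by apply: ge0_ler_powR => //; rewrite nnegrE ltW.
Qed.

Lemma powRN_lt a b s : 0 < a -> a < b -> 0 < s -> b `^ (- s) < a `^ (- s).
Proof.
move=> a0 ab s0; have b0 := lt_trans a0 ab.
rewrite !powRN ltf_pV2 ?posrE ?powR_gt0//.
by apply: gt0_ltr_powR => //; rewrite nnegrE ltW.
Qed.

Lemma powRN_le_inv a b s : 0 < b -> 0 < s -> b `^ (- s) <= a `^ (- s) ->
  0 < a -> a <= b.
Proof.
move=> b0 s0 h a0; rewrite leNgt; apply/negP => ba.
by have := powRN_lt _ _ _ b0 ba s0; rewrite ltNge h.
Qed.

Lemma continuous_at_powR {T : topologicalType} (f : T -> R) (x : T) r :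
  0 < f x -> continuous_at x f -> continuous_at x (fun y => f y `^ r).
Proof.
move=> fx cf.
have c : {for f x, continuous (fun a : R => a `^ r)}.
  apply: differentiable_continuous; apply/derivable1_diffP.
  by have [] := is_derive1_powR r fx.
exact: (@continuous_comp _ _ _ f (fun a => a `^ r)).
Qed.

(** Multiplying by [e `^ s] turns the two terms on the left into positive powers
    of [e], which tend to zero. *)
Lemma powRN_dominates (c d b s1 s2 s : R) : 0 < b -> s1 < s -> s2 < s ->
  \forall e \near 0^'+, c * e `^ (- s1) + d * e `^ (- s2) < b * e `^ (- s).
Proof.
move=> b0 h1 h2.
have H1 : c * a `^ (s - s1) @[a --> 0^'+] --> c * 0.
  by apply: cvgMl_tmp; apply: powR_cvg0; rewrite subr_gt0.
have H2 : d * a `^ (s - s2) @[a --> 0^'+] --> d * 0.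
  by apply: cvgMl_tmp; apply: powR_cvg0; rewrite subr_gt0.
have H : \forall a \near 0^'+, c * a `^ (s - s1) + d * a `^ (s - s2) < b.
  have := cvgD H1 H2; rewrite !mulr0 addr0 => H3.
  exact: (cvgr_lt _ (H3 _) _ b0).
near=> e.
have e0 : 0 < e by near: e; exact: nbhs_right_gt.
have -> : - s1 = s - s1 + (- s) by ring.
have -> : - s2 = s - s2 + (- s) by ring.
have X r : e `^ (r - s) = e `^ r * e `^ (- s).
  by rewrite powRD// (gt_eqF e0) implybT.
rewrite !(X (s - _)) !mulrA -mulrDl ltr_pM2r ?powR_gt0//.
by near: e.
Unshelve. all: by end_near. Qed.

End powR_neg.

(** * Integrals and essential suprema of bounded functions *)

(** The integral of a nonnegative function is a supremum over the simple functions
    below it, and each of these is below [M] times the indicator of [B]. This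
    argument applies to an arbitrary set [D] and an arbitrary function [f]. *)
Lemma Rintegral_le_bounded {d} {T : measurableType d} {R : realType}
    (mu : {measure set T -> \bar R}) (D B : set T) (f : T -> R) (M : R) :
  measurable B -> (mu B < +oo)%E -> D `<=` B -> 0 <= M ->
  (forall x, D x -> 0 <= f x <= M) ->
  \int[mu]_(x in D) f x <= M * fine (mu B).
Proof.
move=> mB muB DB M0 fM; rewrite /Rintegral.
have fin : mu B \is a fin_num by rewrite ge0_fin_numE.
have f0 x : D x -> (0 <= (f x)%:E)%E by move=> /fM/andP[]; rewrite lee_fin.
have : (\int[mu]_(x in D) (f x)%:E <= M%:E * mu B)%E.
  rewrite ge0_integralE//; apply: ge_ereal_sup => _ [h /= hf <-].
  rewrite -integralT_nnsfun -(integral_cst _ mB) [leRHS]integral_mkcond.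
  apply: ge0_le_integral => //.
  - by move=> x _; rewrite lee_fin.
  - exact/measurable_EFinP.
  - by apply/(measurable_restrictT (cst M%:E) mB); exact: measurable_cst.
  - move=> x _; apply: le_trans (hf x) _; rewrite !patchE.
    case: ifPn => [xD|_]; last by case: ifPn => // _; rewrite lee_fin.
    move: xD; rewrite inE => Dx; rewrite mem_set; last exact: DB.
    by rewrite lee_fin; case/andP: (fM _ Dx).
rewrite -(fineK fin) -EFinM.
have := integral_ge0 mu f0.
case: (integral _ _ _) => [r| |] //=.
Qed.

Lemma coord_le_norm {R : realType} {N : nat} (v : 'rV[R]_N) (i : 'I_N) :
  `|v ord0 i| <= `|v|.
Proof.
rewrite [leRHS]/Num.Def.normr/= mx_normrE.
exact: (@le_bigmax _ _ _ 0 (fun ij => `|v ij.1 ij.2|) (ord0, i)).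
Qed.

Lemma bounded_sub_box {R : realType} {N : nat} (Omega : set 'rV[R]_N) :
  bounded_set Omega ->
  exists B : set 'rV[R]_N, [/\ measurable B, (lebesgue_rV N B < +oo)%E & Omega `<=` B].
Proof.
move=> [M [_ bM]]; pose C : R := `|M| + 1; pose I : set R := `[- C, C]%classic.
exists [set v | forall i, I (v ord0 i)]; split.
- rewrite (_ : (fun _ => _) = \bigcap_(i in [set: 'I_N])
    ((fun v : 'rV[R]_N => v ord0 i) @^-1` I)); last first.
    by apply/seteqP; split=> v /= h i; [move=> _|]; exact: h.
  apply: fin_bigcap_measurable => // i _.
  rewrite -[X in measurable X]setTI; apply: measurable_coord => //; exact: measurable_itv.
- rewrite (@lebesgue_rV_box _ _ (fun=> I)); last by move=> _; exact: measurable_itv.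
  suff : (\prod_(i < N) lebesgue_measure I)%E \is a fin_num.
    by rewrite fin_numElt => /andP[].
  apply: (big_ind (fun x : \bar R => x \is a fin_num)) => //; first exact: fin_numM.
  by move=> i _; rewrite lebesgue_measure_itv/=; case: ifP.
- move=> v Ov i /=.
  have := bM C; rewrite /C => /(_ _ _ Ov) h.
  have {}h : `|v| <= C by apply: h; rewrite (le_lt_trans (ler_norm M))// ltrDl.
  have := le_trans (coord_le_norm v i) h.
  by rewrite ler_norml /I/= in_itv/=.
Qed.

Lemma Linfty_norm_le {R : realType} {N : nat} (Omega : set 'rV[R]_N) (f : 'rV[R]_N -> R) (M : R) :
  0 <= M -> (forall x, Omega x -> `|f x| <= M) -> (Linfty_norm Omega f <= M%:E)%E.
Proof.
move=> M0 fM; rewrite /Linfty_norm unlock; case: ifP => // _.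
apply/ess_supP/nearW => x /=; rewrite patchE; case: ifPn => [|_].
  by rewrite inE => /fM; rewrite lee_fin.
by rewrite abse0 lee_fin.
Qed.

(** * The Euclidean scalar product *)

Section dot_theory.
Context {R : realType} {N : nat}.
Implicit Types (x y v w : 'rV[R]_N).

Lemma dotC x y : dot x y = dot y x.
Proof. by apply: eq_bigr => i _; rewrite mulrC. Qed.

Lemma dotDl x y v : dot (x + y) v = dot x v + dot y v.
Proof. by rewrite -big_split; apply: eq_bigr => i _; rewrite mxE mulrDl. Qed.

Lemma dotZl (a : R) x v : dot (a *: x) v = a * dot x v.
Proof. by rewrite mulr_sumr; apply: eq_bigr => i _; rewrite mxE mulrA. Qed.

Lemma dotDr x y v : dot v (x + y) = dot v x + dot v y.
Proof. by rewrite dotC dotDl !(dotC v). Qed.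

Lemma dotZr (a : R) x v : dot v (a *: x) = a * dot v x.
Proof. by rewrite dotC dotZl (dotC v). Qed.

Lemma dot_evec x i : dot x (evec i) = x ord0 i.
Proof.
rewrite /dot (bigD1 i)//= big1 ?addr0; first by rewrite mxE !eqxx mulr1.
by move=> j ji; rewrite mxE (negbTE ji) andbF mulr0.
Qed.

Lemma sqr_coord_le_dot x i : x ord0 i ^+ 2 <= dot x x.
Proof.
rewrite /dot (bigD1 i)//= -expr2 lerDl; apply: sumr_ge0 => j _.
by rewrite -expr2 sqr_ge0.
Qed.

Lemma dot_ge0 x : 0 <= dot x x.
Proof. by apply: sumr_ge0 => j _; rewrite -expr2 sqr_ge0. Qed.

Lemma dot_gt0 x : x != 0 -> 0 < dot x x.
Proof.
move=> x0; rewrite lt_neqAle dot_ge0 andbT eq_sym; apply/contra_neqN: x0 => /eqP d0.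
apply/rowP => i; rewrite mxE; apply/eqP; rewrite -sqrf_eq0.
by rewrite eq_le sqr_ge0 andbT -d0 sqr_coord_le_dot.
Qed.

Lemma norm_le_dot v (r : R) : 0 <= r -> dot v v <= r ^+ 2 -> `|v| <= r.
Proof.
move=> r0 vr; rewrite [leLHS]/Num.Def.normr/= mx_normrE.
apply/bigmax_leP; split => //= -[i j] _ /=; rewrite [i]ord1.
rewrite -(ler_pXn2r (_ : 0 < 2)%N)// ?nnegrE//.
by rewrite real_normK ?num_real// (le_trans (sqr_coord_le_dot v j)).
Qed.

(** A weak form of the Cauchy-Schwarz inequality, from the squared norms of [x + y]
    and [x - y]. *)
Lemma dot_le_half x y : `|2 * dot x y| <= dot x x + dot y y.
Proof.
have h1 := dot_ge0 (x + y); have h2 := dot_ge0 (x + (-1) *: y).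
move: h1 h2; rewrite !dotDl !dotDr !dotZl !dotZr (dotC y x) => h1 h2.
by rewrite ler_norml; apply/andP; split; lra.
Qed.

Lemma continuous_dot_at {T : topologicalType} (f g : T -> 'rV[R]_N) (t : T) :
  (forall i, continuous_at t (fun s => f s ord0 i)) ->
  (forall i, continuous_at t (fun s => g s ord0 i)) ->
  continuous_at t (fun s => dot (f s) (g s)).
Proof.
move=> cf cg; rewrite /dot; elim: (index_enum _) => [|i s IH].
  by under eq_fun do rewrite big_nil; exact: cvg_cst.
under eq_fun do rewrite big_cons.
by apply: (cvgD _ IH); exact: (cvgM (cf i) (cg i)).
Qed.

Lemma continuous_coordB (z : 'rV[R]_N) i :
  continuous (fun x : 'rV[R]_N => (x - z) ord0 i).
Proof.
move=> x; rewrite (_ : (fun y => _) = (fun y : 'rV[R]_N => y ord0 i - z ord0 i)).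
  by apply: continuousB; [exact: coord_continuous|exact: cst_continuous].
by apply/funext => y; rewrite !mxE.
Qed.

Lemma continuous_dot_sq (z : 'rV[R]_N) : continuous (fun x => dot (x - z) (x - z)).
Proof. by move=> x; apply: continuous_dot_at => i; exact: continuous_coordB. Qed.

Lemma is_derive_quad (a b c : R) :
  is_derive (0 : R) 1 (fun h => a + h * b + h ^+ 2 * c) b.
Proof.
have h0 := is_derive_id (0 : R) (1 : R).
have h1 := is_deriveD (is_deriveD (is_derive_cst a (0 : R) (1 : R))
  (is_deriveZ (b : R) h0)) (is_deriveZ (c : R) (is_deriveX 2 h0)).
rewrite (_ : (fun h => _) = (cst a + b \*: id + c \*: id ^+ 2)).
  apply: (@is_derive_eq _ _ _ _ _ _ _ _ h1).
  by rewrite /= /GRing.scale/= expr1 mulr0 mul0r mulr0 mulr1 add0r addr0.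
apply/funext => h.
by rewrite /GRing.add/= /cst [h * b]mulrC [_ * c]mulrC.
Qed.

Lemma is_derive_dot_sq z x v :
  is_derive x v (fun y => dot (y - z) (y - z)) (2 * dot (x - z) v).
Proof.
apply/is_derive_line0.
rewrite (_ : (fun h => _) = fun h => dot (x - z) (x - z) + h * (2 * dot (x - z) v)
  + h ^+ 2 * dot v v); first exact: is_derive_quad.
apply/funext => h; rewrite addrAC; move: (x - z) => w.
rewrite !dotDl !dotDr !dotZl !dotZr (dotC v w).
ring.
Qed.

Lemma is_derive_dot z x v w : is_derive x v (fun y => dot (y - z) w) (dot v w).
Proof.
apply/is_derive_line0.
rewrite (_ : (fun h => _) = fun h => dot (x - z) w + h * dot v w + h ^+ 2 * 0).
  exact: is_derive_quad.
by apply/funext => h; rewrite addrAC; move: (x - z) => y; rewrite dotDl dotZl mulr0 addr0.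
Qed.
End dot_theory.

(** * Smooth boundaries *)

Section layer.
Context {R : realType} {N : nat}.
Implicit Types (x y z v nu : 'rV[R]_N) (Omega W : set 'rV[R]_N)
  (f rho : 'rV[R]_N -> R).

Lemma continuous_at_open W f x :
  open W -> W x -> {within W, continuous f} -> continuous_at x f.
Proof.
by move=> oW Wx; rewrite continuous_open_subspace// => /(_ x); apply; rewrite inE.
Qed.

Lemma class_C2P W f x : open W -> class_C 2 W f -> W x ->
  [/\ continuous_at x f,
      forall i, is_derive x (evec i) f (partial i f x),
      forall i, continuous_at x (partial i f),
      forall i j, is_derive x (evec j) (partial i f) (partial j (partial i f) x) &
      forall i j, continuous_at x (partial j (partial i f))].
Proof.
move=> oW /= [cf H] Wx; split.
- exact: (continuous_at_open W).
- by move=> i; apply: DeriveDef => //; exact: (H i).1.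
- by move=> i; apply: (continuous_at_open W) => //; exact: (H i).2.1.
- by move=> i j; apply: DeriveDef => //; exact: ((H i).2.2 j).1.
- by move=> i j; apply: (continuous_at_open W) => //; exact: ((H i).2.2 j).2.1.
Qed.

Lemma continuous_at_grad W f x i : open W -> class_C 2 W f -> W x ->
  continuous_at x (fun y => grad f y ord0 i).
Proof.
move=> oW Cf Wx; have [_ _ c _ _] := class_C2P _ _ _ oW Cf Wx.
by under eq_fun do rewrite mxE; exact: c.
Qed.

Lemma is_derive_grad W f x v : open W -> class_C 2 W f -> W x ->
  is_derive x v f (dot (grad f x) v).
Proof.
move=> oW Cf Wx; apply: (is_derive_dir W) => //.
  by move=> y /(class_C2P _ _ _ oW Cf)[_ + _ _ _] i; rewrite mxE; exact.
by move=> i; exact: (continuous_at_grad W).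
Qed.

Lemma boundary_open Omega x : open Omega -> boundary Omega x ->
  closure Omega x /\ ~ Omega x.
Proof. by move=> oO [clx nx]; split => // Ox; apply: nx; exact: open_nbhs_nbhs. Qed.

Lemma defining_function_closure_le0 Omega x rho : 
  local_defining_function Omega x rho -> closure Omega x -> rho x <= 0.
Proof.
move=> [W [oW Wx sW OW gW]] clx.
have [c _ _ _ _] := class_C2P _ _ _ oW (sW 2%N) Wx.
rewrite leNgt; apply/negP => h2.
have : nbhs x [set y | W y /\ 0 < rho y].
  apply: filterI; first exact: open_nbhs_nbhs.
  by move: c => /cvgr_gt; apply.
by move=> /clx[y [Oy [Wy]]]; rewrite ltNge ltW//; exact/OW.
Qed.

Lemma defining_function_boundary0 Omega x rho : open Omega ->
  local_defining_function Omega x rho -> boundary Omega x -> rho x = 0.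
Proof.
move=> oO hrho /boundary_open-/(_ oO)[clx nOx].
apply/le_anti; rewrite (defining_function_closure_le0 Omega)//= leNgt.
by case: hrho => W [_ Wx _ OW _]; apply/negP => /(OW _ Wx).
Qed.

(** By continuity at [z], the bounds on the derivatives of a defining function
    are uniform on a small ball. The ball is Euclidean because the squared
    Euclidean distance, which is smooth, will cut off the layer. *)
Lemma boundary_patch Omega z : open Omega -> boundary Omega z ->
  smooth_boundary Omega ->
  exists rho W r C kap, [/\ [/\ open W, class_C 2 W rho, 0 < r, 0 <= C & 0 < kap],
    forall x, W x -> (Omega x <-> rho x < 0),
    forall x, W x -> local_defining_function Omega x rho &
    forall x, dot (x - z) (x - z) <= r ^+ 2 ->
    [/\ W x, kap <= enorm (grad rho x) & forall i,
      `|partial i rho x| <= C /\ `|partial i (partial i rho) x| <= C]].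
Proof.
move=> oO bz /(_ _ bz)[rho [W [oW Wz sW OW gW]]].
have Crho : class_C 2 W rho by exact: sW.
have [_ _ c1 _ c2] := class_C2P _ _ _ oW Crho Wz.
have ge0 : 0 < enorm (grad rho z) by rewrite sqrtr_gt0 dot_gt0// gW.
pose C := \sum_i (`|partial i rho z| + `|partial i (partial i rho) z|) + 1.
have CP i : `|partial i rho z| < C /\ `|partial i (partial i rho) z| < C.
  have h : `|partial i rho z| + `|partial i (partial i rho) z| <= C - 1.
    rewrite /C addrK (bigD1 i)//= lerDl.
    by apply: sumr_ge0 => j _; rewrite addr_ge0.
  have := normr_ge0 (partial i rho z).
  have := normr_ge0 (partial i (partial i rho) z).
  by move: h; split; lra.
have n1 : \forall y \near z, forall i,
    `|partial i rho y| < C /\ `|partial i (partial i rho) y| < C.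
  apply: (@filter_forall _ _ _ (nbhs z) (nbhs_filter z)) => i; near=> y; split; near: y.
    have : `|partial i rho y| @[y --> z] --> `|partial i rho z|.
      exact: (cvg_norm (c1 _)).
    by move/cvgr_lt; apply; exact: (CP i).1.
  have : `|partial i (partial i rho) y| @[y --> z] --> `|partial i (partial i rho) z|.
    exact: (cvg_norm (c2 i i)).
  by move/cvgr_lt; apply; exact: (CP i).2.
have n2 : \forall y \near z, enorm (grad rho z) / 2 < enorm (grad rho y).
  have : enorm (grad rho y) @[y --> z] --> enorm (grad rho z).
    apply: (@continuous_comp _ _ _ (fun y => dot (grad rho y) (grad rho y)) Num.sqrt).
      by apply: continuous_dot_at => i; exact: (continuous_at_grad W).
    exact: sqrt_continuous.
  by move/cvgr_gt; apply; rewrite ltr_pdivrMr// ltr_pMr// ltrDl.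
have n3 : \forall y \near z, W y by exact: open_nbhs_nbhs.
have : nbhs z [set y | W y /\ (enorm (grad rho z) / 2 < enorm (grad rho y) /\
  forall i, `|partial i rho y| < C /\ `|partial i (partial i rho) y| < C)].
  exact: filterI n3 (filterI n2 n1).
move=> /nbhs_ballP[e /= e0 H].
exists rho, W, (e / 2), C, (enorm (grad rho z) / 2); split.
- split; [exact: oW|exact: Crho|exact: divr_gt0| |exact: divr_gt0].
  by rewrite addr_ge0// sumr_ge0// => j _; rewrite addr_ge0.
- exact: OW.
- by move=> x Wx; exists W.
- move=> x xz; have [|h1 [h2 h3]] := H x.
    rewrite -ball_normE /ball_/= distrC.
    apply: le_lt_trans (norm_le_dot _ (e / 2) _ xz) _; first by rewrite divr_ge0// ltW.
    by rewrite ltr_pdivrMr// ltr_pMr// ltr1n.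
  split; [exact: h1|exact: ltW|move=> i].
  by have [? ?] := h3 i; split; exact: ltW.
Unshelve. all: by end_near. Qed.

End layer.

(** * The boundary layer *)

Lemma layer_gradient_bound {R : realFieldType} (e E X p A C r2 : R) :
  0 < e < 1 -> 0 < E <= 1 -> 0 < r2 -> X ^+ 2 <= r2 -> `|p| <= C ->
  (e * (- (2 * X) / r2 - E * (A * p / e) / 4)) ^+ 2 <= 8 / r2 + A ^+ 2 * C ^+ 2 / 8.
Proof.
move=> /andP[e0 e1] /andP[E0 E1] r0 Xr pC.
pose x := 2 * e * X / r2; pose y := E * A * p / 4.
have -> : e * (- (2 * X) / r2 - E * (A * p / e) / 4) = - (x + y).
  by rewrite /x /y; field; rewrite !gt_eqF.
have e2 : e ^+ 2 <= 1 by rewrite expr_le1// ltW.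
have E2 : E ^+ 2 <= 1 by rewrite expr_le1// ltW.
have C0 : 0 <= C by apply: le_trans pC.
have p2 : p ^+ 2 <= C ^+ 2 by rewrite -(real_normK (num_real p)) ler_pXn2r ?nnegrE.
have x2 : x ^+ 2 <= 4 / r2.
  have -> : x ^+ 2 = 4 / r2 * (e ^+ 2 * (X ^+ 2 / r2)).
    by rewrite /x; field; rewrite gt_eqF.
  have r40 : 0 <= 4 / r2 by rewrite divr_ge0// ltW.
  rewrite ler_piMr// mulr_ile1 ?sqr_ge0//.
    by rewrite divr_ge0 ?sqr_ge0// ltW.
  by rewrite ler_pdivrMr// mul1r.
have y2 : y ^+ 2 <= A ^+ 2 * C ^+ 2 / 16.
  have -> : y ^+ 2 = A ^+ 2 * (E ^+ 2 * p ^+ 2) / 16 by rewrite /y; field.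
  rewrite ler_pM2r ?invr_gt0// ler_wpM2l ?sqr_ge0//.
  by apply: le_trans p2; rewrite ler_piMl// sqr_ge0.
have := sqr_ge0 (x - y); rewrite sqrrN !expr2 in x2 y2 * => h.
by nra.
Qed.

Lemma layer_hessian_bound {R : realFieldType} (e E p s A C r2 : R) :
  0 < e < 1 -> 0 < E <= 1 -> 0 < r2 -> 0 <= A -> `|p| <= C -> `|s| <= C ->
  - (e * (- (2 * 1) / r2 - (E * (A * s / e) + E * (A * p / e) ^+ 2) / 4)) <=
  (2 / r2 + A * C / 4 + A ^+ 2 * C ^+ 2 / 4) / e.
Proof.
move=> /andP[e0 e1] /andP[E0 E1] r0 A0 pC sC.
rewrite ler_pdivlMr//.
have -> : - (e * (- (2 * 1) / r2 - (E * (A * s / e) + E * (A * p / e) ^+ 2) / 4)) * e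
  = 2 / r2 * e ^+ 2 + A * (e * E * s) / 4 + A ^+ 2 * (E * p ^+ 2) / 4.
  by field; rewrite !gt_eqF.
have e2 : e ^+ 2 <= 1 by rewrite expr_le1// ltW.
have C0 : 0 <= C by apply: le_trans pC.
have p2 : p ^+ 2 <= C ^+ 2 by rewrite -(real_normK (num_real p)) ler_pXn2r ?nnegrE.
apply: lerD; [apply: lerD|].
- by rewrite ler_piMr// divr_ge0// ltW.
- rewrite ler_pM2r ?invr_gt0// ler_wpM2l//; apply: le_trans (ler_norm _) _.
  rewrite normrM; apply: le_trans sC; rewrite ler_piMl//.
  have eE : 0 <= e * E by rewrite mulr_ge0// ltW.
  by rewrite ger0_norm// mulr_ile1// ltW.
- rewrite ler_pM2r ?invr_gt0// ler_wpM2l ?sqr_ge0//.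
  by apply: le_trans p2; rewrite ler_piMl// sqr_ge0.
Qed.

Section layer.
Context {R : realType} {N : nat}.
Implicit Types (x y z v nu : 'rV[R]_N) (Omega W : set 'rV[R]_N)
  (f rho : 'rV[R]_N -> R).

(** The boundary layer around [z]: the exponential produces the slope at the
    boundary, where it equals 1, and is at most 1 in the domain; the squared
    distance confines the layer to the ball of radius [r]. The constants are such
    that [F] exceeds [3/2 e] at boundary points in the ball of half the radius, and is
    below [3/2 e] when the distance to [z] is [r]. *)
Definition layer rho z (A r e : R) x : R :=
  e * (9 / 4 - dot (x - z) (x - z) / r ^+ 2 - expR (A * rho x / e) / 4).

(** The derivative of [layer] in direction [v], where [drho] is that of [rho]. *)
Definition dlayer rho (drho : 'rV[R]_N -> R) z (A r e : R) v x : R :=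
  e * (- (2 * dot (x - z) v) / r ^+ 2
       - expR (A * rho x / e) * (A * drho x / e) / 4).

Lemma is_derive_exp_scale rho x v (a d : R) : is_derive x v rho d ->
  is_derive x v (fun y => expR (a * rho y)) (expR (a * rho x) * (a * d)).
Proof.
move=> h; exact: (is_derive_comp_dir expR (fun y => a * rho y)).
Qed.

Lemma is_derive_layer rho drho z A r e v x : is_derive x v rho (drho x) ->
  is_derive x v (layer rho z A r e) (dlayer rho drho z A r e v x).
Proof.
move=> /(is_derive_exp_scale _ _ _ (A / e)) hE.
have h := is_deriveZ (e : R) (is_deriveB (is_deriveB (is_derive_cst (9 / 4 : R) x v)
  (is_deriveZ (r ^- 2) (is_derive_dot_sq z x v))) (is_deriveZ (4^-1 : R) hE)).
rewrite (_ : layer _ _ _ _ _ = e \*: (cst (9 / 4 : R) -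
   r ^- 2 \*: (fun y => dot (y - z) (y - z)) -
   4^-1 \*: (fun y => expR (A / e * rho y)))); last first.
  apply/funext => y; rewrite /layer /GRing.scale/= /GRing.scale/= /GRing.add/= /GRing.opp/=.
  by rewrite mulrAC [X in _ = e * (_ - X - _)]mulrC [X in _ = e * (_ - X)]mulrC.
apply: (@is_derive_eq _ _ _ _ _ _ _ _ h).
rewrite /dlayer /GRing.scale/= mulrAC (mulrAC A).
by congr (_ * _); ring.
Qed.

Lemma is_derive_dlayer rho drho z A r e v x d : is_derive x v rho (drho x) ->
  is_derive x v drho d ->
  is_derive x v (dlayer rho drho z A r e v)
    (e * (- (2 * dot v v) / r ^+ 2
       - (expR (A * rho x / e) * (A * d / e) +
          expR (A * rho x / e) * (A * drho x / e) ^+ 2) / 4)).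
Proof.
move=> /(is_derive_exp_scale _ _ _ (A / e)) hE hd.
have h := is_deriveZ (e : R) (is_deriveB
  (is_deriveZ (- 2 / r ^+ 2) (is_derive_dot z x v v))
  (is_deriveZ (4^-1 : R) (is_deriveM hE (is_deriveZ (A / e) hd)))).
rewrite (_ : dlayer _ _ _ _ _ _ _ = e \*: ((- 2 / r ^+ 2) \*: (fun y => dot (y - z) v) -
   4^-1 \*: ((fun y => expR (A / e * rho y)) * ((A / e) \*: drho)))); last first.
  apply/funext => y; rewrite /dlayer (mulrAC A (rho y)) /=.
  transitivity (e * ((- 2 / r ^+ 2) * dot (y - z) v -
    4^-1 * (expR (A / e * rho y) * (A / e * drho y)))) => //.
  ring.
apply: (@is_derive_eq _ _ _ _ _ _ _ _ h).
rewrite /GRing.scale/= /GRing.scale/= mulrAC (mulrAC A).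
by congr (_ * _); ring.
Qed.

Lemma continuous_at_layer rho z A r e x : continuous_at x rho ->
  continuous_at x (layer rho z A r e).
Proof.
move=> cr.
have cE : continuous_at x (fun y => expR (A * rho y / e)).
  apply: continuous_at_expR; apply: continuous_atM; last exact: continuous_at_cst.
  by apply: continuous_atM => //; exact: continuous_at_cst.
apply: continuous_atM; first exact: continuous_at_cst.
apply: continuous_atB; last by apply: continuous_atM => //; exact: continuous_at_cst.
apply: continuous_atB; first exact: continuous_at_cst.
by apply: continuous_atM; [exact: continuous_dot_sq|exact: continuous_at_cst].
Qed.

Lemma continuous_at_dlayer rho drho z A r e v x : continuous_at x rho ->
  continuous_at x drho -> continuous_at x (dlayer rho drho z A r e v).
Proof.
move=> cr cd.
have cE : continuous_at x (fun y => expR (A * rho y / e)).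
  apply: continuous_at_expR; apply: continuous_atM; last exact: continuous_at_cst.
  by apply: continuous_atM => //; exact: continuous_at_cst.
apply: continuous_atM; first exact: continuous_at_cst.
apply: continuous_atB; last first.
  apply: continuous_atM; last exact: continuous_at_cst.
  apply: continuous_atM => //; apply: continuous_atM; last exact: continuous_at_cst.
  by apply: continuous_atM => //; exact: continuous_at_cst.
apply: continuous_atM; last exact: continuous_at_cst.
apply: continuous_atN; apply: continuous_atM; first exact: continuous_at_cst.
apply: continuous_dot_at => i; first exact: continuous_coordB.
exact: continuous_at_cst.
Qed.

(** What the comparison uses of a layer [F] of size [e], in this order: its values
    on the ball; it matters (exceeds the constant [3/2 e]) only inside the open
    ball; it exceeds the constant on the half-radius part of the boundary; its
    second derivatives are at worst of order [1 / e]; and its slope at the boundary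
    is below [- K], along a normal whose opposite enters the domain. *)
Definition upper_layer Omega z (r C K e : R) (F : 'rV[R]_N -> R) : Prop :=
  [/\ forall x, closure Omega x -> dot (x - z) (x - z) <= r ^+ 2 ->
        [/\ e <= F x, F x <= 9 / 4 * e & continuous_at x F],
      forall x, 3 / 2 * e <= F x -> dot (x - z) (x - z) < r ^+ 2,
      forall x, boundary Omega x -> dot (x - z) (x - z) < r ^+ 2 / 4 ->
        3 / 2 * e < F x,
      forall x i, Omega x -> dot (x - z) (x - z) <= r ^+ 2 ->
        exists F1 F2, [/\ \forall y \near x, is_derive y (evec i) F (F1 y),
          is_derive x (evec i) F1 F2, F1 x ^+ 2 <= C & - F2 <= C / e] &
      forall x, boundary Omega x -> dot (x - z) (x - z) <= r ^+ 2 ->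
        exists nu dF, [/\ outward_unit_normal Omega x nu,
          \forall s \near 0^'+, Omega (x - s *: nu),
          \forall y \near x, is_derive y nu F (dF y),
          continuous_at x dF & dF x < - K]].

(** The slope at the boundary is [- A |grad rho| / 4] up to an error of order [e],
    whence the choice of [A]. The cut-off contributes only terms of order [e]. *)
Lemma layer_exists Omega z (K : R) : open Omega -> smooth_boundary Omega ->
  boundary Omega z -> 0 < K ->
  exists r C (F : R -> 'rV[R]_N -> R), 0 < r /\ 0 <= C /\
    \forall e \near 0^'+, upper_layer Omega z r C K e (F e).
Proof.
move=> oO sO bz K0.
have [rho [W [r [C [kap [[oW Crho r0 C0 kap0] OW locW HW]]]]]] :=
  boundary_patch _ _ oO bz sO.
(* The slope [- A kap / 4] is [- (K + 1)]: the spare 1 absorbs the cut-off. *)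
pose A := 4 * (K + 1) / kap.
have A0 : 0 < A by rewrite /A divr_gt0// mulr_gt0//; lra.
have rr0 : 0 < r ^+ 2 by rewrite exprn_gt0.
pose C' := 8 / r ^+ 2 + A ^+ 2 * C ^+ 2 / 8 + A * C / 4 + A ^+ 2 * C ^+ 2 / 4.
have AC0 : 0 <= A * C by rewrite mulr_ge0// ltW.
have A2C2 : 0 <= A ^+ 2 * C ^+ 2 by rewrite -exprMn sqr_ge0.
have r80 : 0 < 8 / r ^+ 2 by rewrite divr_gt0.
exists r, C', (fun e => layer rho z A r e); split => //; split.
  by rewrite /C'; lra.
near=> e.
have e0 : 0 < e by near: e; exact: nbhs_right_gt.
have e1 : e < 1 by near: e; exact: nbhs_right_lt.
have e2 : e < r ^+ 2 / (r ^+ 2 + 1).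
  by near: e; apply: nbhs_right_lt; rewrite divr_gt0// addr_gt0.
have bnd x : dot (x - z) (x - z) <= r ^+ 2 -> 0 <= dot (x - z) (x - z) / r ^+ 2 <= 1.
  by move=> h; rewrite divr_ge0 ?dot_ge0 ?sqr_ge0//= ler_pdivrMr// mul1r.
have Ele x : W x -> closure Omega x -> 0 < expR (A * rho x / e) <= 1.
  move=> Wx clx; rewrite expR_gt0/= -expR0 ler_expR.
  have := defining_function_closure_le0 _ _ _ (locW _ Wx) clx => h.
  by rewrite pmulr_lle0 ?invr_gt0// pmulr_rle0.
split.
- move=> x clx hx; have [Wx _ _] := HW x hx.
  have /andP[t0 t1] := bnd x hx.
  have /andP[E0 E1] := Ele x Wx clx.
  split.
  + by rewrite /layer -[leLHS]mulr1 ler_pM2l//; lra.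
  + by rewrite /layer mulrC ler_pM2r//; lra.
  + by apply: continuous_at_layer; have [] := class_C2P _ _ _ oW Crho Wx.
- move=> x; rewrite /layer mulrC ler_pM2l// => h.
  have := expR_gt0 (A * rho x / e) => E0.
  have : dot (x - z) (x - z) / r ^+ 2 < 1 by lra.
  by rewrite ltr_pdivrMr// mul1r.
- move=> x bx hx.
  have hx' : dot (x - z) (x - z) <= r ^+ 2 by apply: (le_trans (ltW hx)); lra.
  have [Wx _ _] := HW x hx'.
  rewrite /layer mulrC ltr_pM2l// (defining_function_boundary0 _ _ _ oO (locW _ Wx) bx).
  rewrite mulr0 mul0r expR0.
  have : dot (x - z) (x - z) / r ^+ 2 < 1 / 4 by rewrite ltr_pdivrMr//; lra.
  lra.
- move=> x i Ox hx; have [Wx _ /(_ i)[d1 d2]] := HW x hx.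
  have [_ h1 _ h2 _] := class_C2P _ _ _ oW Crho Wx.
  exists (dlayer rho (partial i rho) z A r e (evec i)).
  eexists; split.
  + have nW : \forall y \near x, W y by exact: open_nbhs_nbhs.
    near=> y; apply: is_derive_layer.
    have Wy : W y by near: y.
    by have [] := class_C2P _ _ _ oW Crho Wy.
  + exact: is_derive_dlayer.
  + have /andP[E0 E1] := Ele x Wx (subset_closure Ox).
    rewrite /dlayer dot_evec.
    apply: (le_trans (layer_gradient_bound _ _ _ _ A C (r ^+ 2) _ _ rr0 _ d1)).
    * by rewrite e0.
    * by rewrite E0.
    * exact: le_trans (sqr_coord_le_dot _ _) hx.
    * by rewrite /C'; lra.
  + have /andP[E0 E1] := Ele x Wx (subset_closure Ox).
    have -> : dot (evec i) (evec i) = 1 :> R by rewrite dot_evec mxE !eqxx.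
    apply: (le_trans (layer_hessian_bound _ _ _ _ A C _ _ _ rr0 (ltW A0) d1 d2)).
    * by rewrite e0.
    * by rewrite E0.
    * by rewrite ler_pM2r ?invr_gt0// /C'; lra.
- move=> x bx hx; have [Wx hg _] := HW x hx.
  pose nu := (enorm (grad rho x))^-1 *: grad rho x.
  have g0 : 0 < enorm (grad rho x) by apply: lt_le_trans hg.
  have dotgg : dot (grad rho x) (grad rho x) = enorm (grad rho x) ^+ 2.
    by rewrite /enorm sqr_sqrtr// dot_ge0.
  have gnu : dot (grad rho x) nu = enorm (grad rho x).
    by rewrite /nu dotZr dotgg; field; rewrite gt_eqF.
  have nunu : dot nu nu = 1.
    by rewrite {1}/nu dotZl gnu mulVf// gt_eqF.
  have rx0 := defining_function_boundary0 _ _ _ oO (locW _ Wx) bx.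
  exists nu, (dlayer rho (fun y => dot (grad rho y) nu) z A r e nu); split.
  + by exists rho => //; exact: locW.
  + have nW : \forall t \near (0 : R), W (x + t *: nu).
      by apply: near_line; exact: open_nbhs_nbhs.
    have nW' : \forall s \near 0^'+, W (x + (- s) *: nu).
      move: nW => /nbhs_ballP[e' /= e'0 H]; exists e' => //= s se s0.
      by apply: H; rewrite /ball/= sub0r opprK; rewrite /ball/= sub0r normrN in se.
    have hd : is_derive (0 : R) 1 (fun h => rho (x + h *: nu)) (enorm (grad rho x)).
      by apply/(is_derive_line0 rho x nu); rewrite -gnu; apply: (is_derive_grad W).
    have := derive_gt0_left _ _ hd g0; rewrite scale0r addr0 rx0 => nrho.
    near=> s; rewrite -scaleNr; apply/OW; near: s; [exact: nW'|exact: nrho].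
  + have nW : \forall y \near x, W y by exact: open_nbhs_nbhs.
    near=> y; apply: is_derive_layer; apply: (is_derive_grad W) => //.
    by near: y.
  + apply: continuous_at_dlayer; first by have [] := class_C2P _ _ _ oW Crho Wx.
    apply: continuous_dot_at => i; last exact: continuous_at_cst.
    exact: (continuous_at_grad W).
  + rewrite /dlayer rx0 mulr0 mul0r expR0 gnu mul1r.
    have h1 : - (2 * dot (x - z) nu) <= r ^+ 2 + 1.
      have := dot_le_half (x - z) nu; rewrite nunu ler_norml => /andP[h _]; lra.
    have h2 : e * (r ^+ 2 + 1) < r ^+ 2 by rewrite -ltr_pdivlMr// addr_gt0.
    have h3 : 4 * (K + 1) <= A * enorm (grad rho x).
      rewrite (_ : 4 * (K + 1) = A * kap); last by rewrite /A divfK// gt_eqF.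
      by rewrite ler_pM2l.
    have h4 : e * (- (2 * dot (x - z) nu) / r ^+ 2) < 1.
      rewrite mulrA ltr_pdivrMr// mul1r; apply: le_lt_trans h2.
      by rewrite ler_pM2l.
    have -> : e * (- (2 * dot (x - z) nu) / r ^+ 2 - A * enorm (grad rho x) / e / 4) =
      e * (- (2 * dot (x - z) nu) / r ^+ 2) - A * enorm (grad rho x) / 4.
      by field; rewrite !gt_eqF.
    lra.
Unshelve. all: by end_near. Qed.

End layer.

(** * Contact of a solution with a barrier *)

Section interior_contact.
Context {R : realType} {N : nat}.
Implicit Types (x : 'rV[R]_N) (Omega : set 'rV[R]_N) (u F : 'rV[R]_N -> R).

(** At a contact point [F `^ (- (m / gam)) - u `^ m] has a local minimum equal to 0, so
    along every axis its second derivative is nonnegative. Two derivatives of a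
    negative power of [F] cost a factor [e ^- 2] for [F1 ^+ 2], and, [F2] being
    of order [1 / e], the same for the term in [F2]. *)
Lemma laplacian_contact_le Omega x u F (m gam e C : R) :
  open Omega -> Omega x -> 0 < m -> 0 < gam -> 0 < e -> 0 <= C ->
  (forall y, Omega y -> 0 < u y) ->
  (forall i y, Omega y -> derivable u y (evec i)) ->
  (forall i, derivable (partial i u) x (evec i)) ->
  continuous_at x F -> e <= F x ->
  (forall i, exists F1 (F2 : R), [/\ \forall y \near x, is_derive y (evec i) F (F1 y),
          is_derive x (evec i) F1 F2, F1 x ^+ 2 <= C & - F2 <= C / e]) ->
  (\forall y \near x, u y <= F y `^ (- gam^-1)) ->
  u x = F x `^ (- gam^-1) ->
  laplacian (fun y => u y `^ m) x <=
    N%:R * (m / gam * (m / gam + 2) * C) * e `^ (- (m / gam + 2)).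
Proof.
move=> oO Ox m0 g0 e0 C0 u0 du ddu cF eF HF uF uFx.
set be := m / gam.
have be0 : 0 < be by exact: divr_gt0.
have Fx : 0 < F x by apply: lt_le_trans eF.
have nO : \forall y \near x, Omega y by exact: open_nbhs_nbhs.
have nF : \forall y \near x, 0 < F y by move: cF => /cvgr_gt; apply.
have bem : - gam^-1 * m = - be by rewrite /be mulNr mulrC.
rewrite /laplacian.
have -> : N%:R * (be * (be + 2) * C) * e `^ (- (be + 2)) =
    \sum_(i < N) (be * (be + 2) * C * e `^ (- (be + 2))).
  by rewrite sumr_const card_ord -[RHS]mulr_natl; ring.
apply: ler_sum => i _.
have [F1 [F2 [dF dF1 hF1 hF2]]] := HF i.
pose du_m y := m * u y `^ (m - 1) * partial i u y.
have dum y : Omega y -> is_derive y (evec i) (fun y => u y `^ m) (du_m y).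
  move=> Oy; apply: is_derive_powR_comp; first exact: u0.
  by apply: DeriveDef => //; exact: du.
have E y : Omega y -> partial i (fun y => u y `^ m) y = du_m y.
  by move=> /dum[].
have ddum : is_derive x (evec i) (partial i (fun y => u y `^ m))
    (partial i (partial i (fun y => u y `^ m)) x).
  apply: DeriveDef => //.
  suff [h _] : is_derive x (evec i) (partial i (fun y => u y `^ m)) (
     m * (m - 1) * u x `^ (m - 2) * partial i u x ^+ 2
     + m * u x `^ (m - 1) * partial i (partial i u) x) by [].
  apply: (@near_eq_is_derive _ _ _ du_m).
    by near=> y; rewrite E//; near: y.
  apply: is_derive_powR_comp2; first exact: u0.
    by apply: DeriveDef => //; exact: du.
  by apply: DeriveDef => //; exact: ddu.
have dG : \forall y \near x,
    is_derive y (evec i) (fun y => F y `^ (- be)) (- be * F y `^ (- be - 1) * F1 y).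
  near=> y; apply: is_derive_powR_comp; first by near: y.
  by near: y.
have ddG := is_derive_powR_comp2 _ _ _ _ (- be) _ Fx (nbhs_singleton dF) dF1.
have test := @second_derivative_test_dir R _
  (fun y => F y `^ (- be) - u y `^ m)
  (fun y => - be * F y `^ (- be - 1) * F1 y - partial i (fun y => u y `^ m) y)
  x (evec i) _ _ (is_deriveB ddG ddum) _.
have {test} : 0 <= - be * (- be - 1) * F x `^ (- be - 2) * F1 x ^+ 2 +
   - be * F x `^ (- be - 1) * F2 - partial i (partial i (fun y => u y `^ m)) x.
  apply: test.
    near=> y.
    have Oy : Omega y by near: y.
    apply: is_deriveB; first by near: y.
    by rewrite E//; exact: dum.
  near=> y.
  rewrite uFx -powRrM bem subrr subr_ge0 -bem powRrM.
  apply: ge0_ler_powR; [exact: ltW| | |by near: y].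
    by rewrite nnegrE ltW// u0//; near: y.
  by rewrite nnegrE powR_ge0.
rewrite subr_ge0 => /le_trans; apply.
have -> : - be * (- be - 1) * F x `^ (- be - 2) * F1 x ^+ 2 +
   - be * F x `^ (- be - 1) * F2 = be * (be + 1) * (F x `^ (- (be + 2)) * F1 x ^+ 2)
   + be * (F x `^ (- (be + 1)) * - F2).
  have -> : - be - 2 = - (be + 2) by ring.
  have -> : - be - 1 = - (be + 1) by ring.
  ring.
have -> : be * (be + 2) * C * e `^ (- (be + 2)) =
   be * (be + 1) * (e `^ (- (be + 2)) * C) + be * (e `^ (- (be + 1)) * (C / e)).
  have -> : e `^ (- (be + 1)) = e `^ (- (be + 2)) * e.
    have -> : - (be + 1) = - (be + 2) + 1 by ring.
    rewrite powRD; first by rewrite powRr1// ltW.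
    by rewrite (gt_eqF e0) implybT.
  by field; rewrite gt_eqF.
apply: lerD.
  have be1 : 0 < be * (be + 1) by rewrite mulr_gt0// addr_gt0.
  rewrite ler_pM2l//.
  apply: ler_pM => //; [exact: powR_ge0|exact: sqr_ge0|].
  by apply: powRN_le => //; rewrite addr_ge0// ltW.
rewrite ler_pM2l//.
apply: le_trans (_ : F x `^ (- (be + 1)) * (C / e) <= _).
  by rewrite ler_wpM2l// powR_ge0.
rewrite ler_wpM2r ?divr_ge0 ?(ltW e0)//.
by apply: powRN_le => //; rewrite addr_ge0// ltW.
Unshelve. all: by end_near. Qed.

End interior_contact.

Section boundary_contact.
Context {R : realType} {N : nat}.
Implicit Types (x nu : 'rV[R]_N) (Omega : set 'rV[R]_N) (u F : 'rV[R]_N -> R).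

(** [G] is the derivative of [F `^ (- gam^-1) - u] along [nu], positive at [x] and,
    by continuity of the gradient up to the boundary, near [x] in the closure. So
    this function decreases from its value 0 at [x] when moving inwards, which
    contradicts [u <= F `^ (- gam^-1)]. *)
Lemma boundary_contact_absurd Omega x nu u (Du : 'rV[R]_N -> 'rV[R]_N) F
    (dF : 'rV[R]_N -> R) (gam k : R) :
  open Omega -> closure Omega x -> 0 < gam ->
  (\forall s \near 0^'+, Omega (x - s *: nu)) ->
  {within closure Omega, continuous u} ->
  {within closure Omega, continuous Du} ->
  (forall y, Omega y -> forall i, is_derive y (evec i) u (Du y ord0 i)) ->
  continuous_at x F -> 0 < F x ->
  (\forall y \near x, is_derive y nu F (dF y)) -> continuous_at x dF ->
  dF x < - (k * gam) ->
  (\forall y \near x, Omega y -> u y <= F y `^ (- gam^-1)) ->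
  u x = F x `^ (- gam^-1) ->
  ~ dot (Du x) nu <= k * u x `^ (gam + 1).
Proof.
move=> oO clx g0 inO cu cDu du cF F0 dFn cdF dFx uF uFx flux.
pose G y := - gam^-1 * F y `^ (- gam^-1 - 1) * dF y - dot (Du y) nu.
have Gx : 0 < G x.
  rewrite /G subr_gt0; apply: le_lt_trans flux _.
  rewrite uFx -powRrM (_ : - gam^-1 * (gam + 1) = - gam^-1 - 1); last first.
    by field; rewrite gt_eqF.
  have Fp : 0 < F x `^ (- gam^-1 - 1) by exact: powR_gt0.
  rewrite (_ : - gam^-1 * _ * dF x = (gam^-1 * - dF x) * F x `^ (- gam^-1 - 1)); last by ring.
  by rewrite ltr_pM2r// mulrC ltr_pdivlMr// ltrNr.
have cDui i : {within closure Omega, continuous (fun y => Du y ord0 i)}.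
  move=> y; apply: (@continuous_comp _ _ _ (Du : subspace _ -> _)
    (fun M : 'rV[R]_N => M ord0 i)); [exact: cDu|exact: coord_continuous].
have cG : G @ within (closure Omega) (nbhs x) --> G x.
  have wF : continuous_at x (fun y => - gam^-1 * F y `^ (- gam^-1 - 1) * dF y).
    apply: continuous_atM => //; apply: continuous_atM; first exact: continuous_at_cst.
    exact: continuous_at_powR.
  apply: cvgB; first exact: cvg_within_filter wF.
  rewrite /dot; elim: (index_enum _) => [|i s IH].
    under eq_fun do rewrite big_nil; rewrite big_nil; exact: cvg_cst.
  under eq_fun do rewrite big_cons.
  rewrite big_cons; apply: cvgD => //; apply: cvgM; last exact: cvg_cst.
  by move: (cDui i) => /subspace_continuousP; apply.
have {cG} nG : \forall y \near x, closure Omega y -> 0 < G y.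
  by move: cG => /cvgr_gt /(_ _ Gx).
have nF : \forall y \near x, 0 < F y by move: cF => /cvgr_gt; apply.
have nall : \forall y \near x, (closure Omega y -> 0 < G y) /\ 0 < F y /\
    is_derive y nu F (dF y) /\ (Omega y -> u y <= F y `^ (- gam^-1)).
  by near=> y; split; [|split; [|split]]; near: y.
move: (near_line _ nu _ nall) => /nbhs_ballP[e2 /= e20 H].
move: inO => [e1 /= e10 inO].
pose s := Num.min e1 e2 / 2.
have m0 : 0 < Num.min e1 e2 by rewrite lt_min e10.
have s0 : 0 < s by rewrite /s divr_gt0.
have sm : s < Num.min e1 e2 by rewrite /s ltr_pdivrMr// ltr_pMr// ltrDl.
have tO (t : R) : - s <= t < 0 -> Omega (x + t *: nu).
  move=> /andP[st t0]; rewrite -[t]opprK scaleNr; apply: inO; last by rewrite oppr_gt0.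
  rewrite /= sub0r opprK ltr0_norm//.
  by move: sm; rewrite lt_min => /andP[h _]; lra.
have tcl (t : R) : - s <= t <= 0 -> closure Omega (x + t *: nu).
  move=> /andP[st]; rewrite le_eqVlt => /predU1P[->|t0].
    by rewrite scale0r addr0.
  by apply: subset_closure; apply: tO; rewrite st.
have tb (t : R) : - s <= t <= 0 -> ball 0 e2 t.
  move=> /andP[st t0]; rewrite /ball/= sub0r normrN ler0_norm//.
  by move: sm; rewrite lt_min => /andP[_ h]; lra.
pose phi (t : R) := F (x + t *: nu) `^ (- gam^-1) - u (x + t *: nu).
have [|||c] := @MVT R phi (fun t => G (x + t *: nu)) (- s) 0.
- by rewrite oppr_lt0.
- move=> t; rewrite in_itv/= => /andP[st t0].
  have stb : - s <= t <= 0 by rewrite !ltW.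
  have [_ [Fp [dFt _]]] := H t (tb t stb).
  apply: is_deriveB.
    by apply/(is_derive_line (fun y => F y `^ (- gam^-1))); exact: is_derive_powR_comp.
  apply/is_derive_line; apply: (is_derive_dir Omega) => //.
    by apply: tO; rewrite (ltW st).
  move=> i; apply: (continuous_at_open Omega) => //; first by apply: tO; rewrite (ltW st).
  exact: continuous_subspaceW (@subset_closure _ Omega) (cDui i).
- have c1 : {within `[- s, 0], continuous (fun t : R => F (x + t *: nu) `^ (- gam^-1))}.
    apply: derivable_within_continuous => t; rewrite in_itv/= => ht.
    have [_ [Fp [dFt _]]] := H t (tb t ht).
    suff [h _] : is_derive (t : R) 1 (fun t => F (x + t *: nu) `^ (- gam^-1))
      (- gam^-1 * F (x + t *: nu) `^ (- gam^-1 - 1) * dF (x + t *: nu)) by [].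
    by apply/(is_derive_line (fun y => F y `^ (- gam^-1))); exact: is_derive_powR_comp.
  have c2 : {within `[- s, 0], continuous (fun t : R => u (x + t *: nu))}.
    apply: (continuous_within_comp (closure Omega) _ (fun t : R => x + t *: nu)) => //.
      have h t := @scalel_continuous _ _ nu (t : R).
      by move=> t; exact: (cvgD (cvg_cst x) (h t)).

  by move=> t; exact: (cvgB (c1 t) (c2 t)).
rewrite in_itv/= => /andP[sc c0].
have scb : - s <= c <= 0 by rewrite !ltW.
have [+ _] := H c (tb c scb) => /(_ (tcl c scb)) Gc.
have ssb : - s <= - s <= 0 by rewrite lexx oppr_le0 ltW.
have [_ [_ [_ us]]] := H (- s) (tb _ ssb).
have {}us : 0 <= phi (- s).
  by rewrite /phi subr_ge0; apply: us; apply: tO; rewrite lexx oppr_lt0.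
have -> : phi 0 = 0 by rewrite /phi scale0r addr0 uFx subrr.
rewrite !sub0r opprK => E.
have : 0 < - phi (- s) by rewrite E mulr_gt0.
by rewrite oppr_gt0 ltNge us.
Unshelve. all: by end_near. Qed.

End boundary_contact.

(** * The uniform bound *)

Section bound.
Context {R : realType} {N : nat}.
Implicit Types (x y z : 'rV[R]_N) (Omega : set 'rV[R]_N).

Lemma compact_closure_bounded Omega : bounded_set Omega -> compact (closure Omega).
Proof.
move=> [M [Mreal bM]]; apply: bounded_closed_compact; last exact: closed_closure.
exists M; split => // r Mr.
have cl : closed [set y : 'rV[R]_N | `|y| <= r].
  apply: (@closed_comp _ _ (fun y : 'rV[R]_N => `|y|) [set a | a <= r]).
    by move=> y _; exact: norm_continuous.
  exact: closed_le.
by move=> y /(closureS (bM r Mr)); rewrite -(closure_id _).1.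
Qed.

Lemma compact_boundary Omega : bounded_set Omega -> compact (boundary Omega).
Proof.
move=> /compact_closure_bounded c; apply: compact_closedI => //.
by apply: open_closedC; exact: open_interior.
Qed.

(** The half-radius balls around the points of the compact boundary cover it. *)
Lemma finite_layers Omega (K : R) : open Omega -> bounded_set Omega ->
  smooth_boundary Omega -> 0 < K ->
  exists (D : seq 'rV[R]_N) (r C : 'rV[R]_N -> R) (F : 'rV[R]_N -> R -> 'rV[R]_N -> R),
   [/\ forall z, z \in D -> [/\ 0 < r z, 0 <= C z &
         \forall e \near 0^'+, upper_layer Omega z (r z) (C z) K e (F z e)] &
       forall x, boundary Omega x ->
         exists2 z, z \in D & dot (x - z) (x - z) < r z ^+ 2 / 4].
Proof.
move=> oO bO sO K0.
have cbd := compact_boundary _ bO.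
pose P z (d : R * R * (R -> 'rV[R]_N -> R)) := boundary Omega z ->
  [/\ 0 < d.1.1, 0 <= d.1.2 &
         \forall e \near 0^'+, upper_layer Omega z d.1.1 d.1.2 K e (d.2 e)].
have /choice[d dP] : forall z, exists d, P z d.
  move=> z; have [bz|nbz] := pselect (boundary Omega z); last first.
    by exists (0, 0, fun _ _ => 0).
  have [r [C [F [r0 [C0 HF]]]]] := layer_exists Omega z K oO sO bz K0.
  by exists (r, C, F).
move: cbd; rewrite compact_cover => /(_ _ (boundary Omega)
  (fun z => [set x | dot (x - z) (x - z) < (d z).1.1 ^+ 2 / 4])).
case.
- move=> z bz.
  apply: (@open_comp _ _ (fun x => dot (x - z) (x - z)) [set a | a < (d z).1.1 ^+ 2 / 4]).
    by move=> x _; exact: continuous_dot_sq.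
  exact: open_lt.
- move=> x bx; exists x => //=.
  by rewrite subrr /dot big1 ?divr_gt0 ?exprn_gt0//; [have [] := dP x bx|move=> i _; rewrite mxE mul0r].
move=> D sD covD.
exists (finmap.enum_fset D), (fun z => (d z).1.1), (fun z => (d z).1.2), (fun z => (d z).2).
split.
  by move=> z zD; apply: dP; have := sD z zD; rewrite inE.
by move=> x /covD[z zD] h; exists z.
Qed.

(** The comparison argument. The index [None] stands for the constant barrier,
    and [Some z] for the layer around [z]. *)
Lemma sup_bound Omega (a b c k m p q : R) (g : R -> R) (u0 : 'rV[R]_N -> R)
    (T : \bar R) (u : 'rV[R]_N -> R -> R) :
  open Omega -> bounded_set Omega -> smooth_boundary Omega ->
  0 < a -> 0 < b -> 0 < c -> 0 < k -> 1 < m -> m < p -> p < q ->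
  2 * p < m + q ->
  (forall xi, 0 <= xi -> g xi <= k * xi `^ (p - m + 1)) ->
  classical_solution Omega a b c m p q g u0 T u ->
  exists2 M, 0 < M & forall x t, closure Omega x -> 0 <= t -> (t%:E < T)%E ->
    u x t < M.
Proof.
move=> oO bO sO a0 b0 c0 k0 m1 mp pq h2p hg.
move=> [T0 upos [Cu [dut _] dux ddux] pde [[Du [cu cDu du] bc] init]].
pose gam := p - m.
have g0 : 0 < gam by rewrite subr_gt0.
have m0 : 0 < m by lra.
have gi0 : 0 < gam^-1 by rewrite invr_gt0.
have K0 : 0 < k * gam by rewrite mulr_gt0.
have [D [r [C [F [HD covD]]]]] := finite_layers Omega (k * gam) oO bO sO K0.
have cO := compact_closure_bounded _ bO.
have [B [mB finB OB]] := bounded_sub_box Omega bO.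
pose V := fine (lebesgue_rV N B).
have cut (t : R) : 0 <= t -> (t%:E < T)%E -> {within closure Omega, continuous (fun y => u y t)}.
  move=> t0 tT; apply: (continuous_within_comp _ _ (fun y => (y, t)) _ cu) => //.
  exact: continuous_pairr.
have [M0 M00 HM0] : exists2 M0, 0 < M0 & forall x, closure Omega x -> u x 0 <= M0.
  have [[y0 cly0]|noc] := pselect (closure Omega !=set0); last first.
    by exists 1 => // x clx; exfalso; apply: noc; exists x.
  have [y _ hy] := EVT_max_rV (ex_intro _ y0 cly0) cO (cut 0 (lexx _) T0).
  exists (Num.max (u y 0) 1); first by rewrite lt_max ltr01 orbT.
  by move=> x clx; rewrite le_max hy// inE.
pose L (Cz : R) := N%:R * (m / gam * (m / gam + 2) * Cz).
have p0 : 0 <= p by lra.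
have pg0 : 0 <= p / gam by rewrite divr_ge0// ltW.
have qg0 : 0 <= q / gam by rewrite divr_ge0 ?(ltW g0)//; lra.
(* The hypothesis [2 p < m + q] in the form [m + 2 gam < q]. *)
have mg : m / gam + 2 < q / gam.
  rewrite ltr_pdivlMr// mulrDl divfK ?gt_eqF//; rewrite /gam; lra.
have near_pde (Cz : R) : \forall e \near 0^'+,
    L Cz * e `^ (- (m / gam + 2)) + a * V * e `^ (- (p / gam)) <
      b * (9 / 4) `^ (- (q / gam)) * e `^ (- (q / gam)).
  apply: powRN_dominates => //; first by rewrite mulr_gt0// powR_gt0.
  by rewrite ltr_pM2r.
(* The constant [M0] is written with the power [e `^ (- 0) = 1], and is
   dominated in the same way. *)
have near_init : \forall e \near 0^'+,
    M0 * e `^ (- 0) + 0 * e `^ (- 0) < (9 / 4) `^ (- gam^-1) * e `^ (- gam^-1).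
  by apply: powRN_dominates => //; exact: powR_gt0.
have near_D : \forall e \near 0^'+, forall z, z \in D ->
    upper_layer Omega z (r z) (C z) (k * gam) e (F z e) /\
    L (C z) * e `^ (- (m / gam + 2)) + a * V * e `^ (- (p / gam)) <
      b * (9 / 4) `^ (- (q / gam)) * e `^ (- (q / gam)).
  apply: near_seq => z zD; have [_ _ nz] := HD z zD.
  have := near_pde (C z).
  by move=> npde; near=> e; split; near: e.
have [e [e0 [[He0 Hinit] HeD]]] : exists e : R, 0 < e /\
    ((L 0 * e `^ (- (m / gam + 2)) + a * V * e `^ (- (p / gam)) <
      b * (9 / 4) `^ (- (q / gam)) * e `^ (- (q / gam)) /\
     M0 * e `^ (- 0) + 0 * e `^ (- 0) < (9 / 4) `^ (- gam^-1) * e `^ (- gam^-1)) /\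
    forall z, z \in D -> upper_layer Omega z (r z) (C z) (k * gam) e (F z e) /\
    L (C z) * e `^ (- (m / gam + 2)) + a * V * e `^ (- (p / gam)) <
      b * (9 / 4) `^ (- (q / gam)) * e `^ (- (q / gam))).
  apply: (@filter_ex _ (0^'+)).
  near=> e; split; first by near: e; exact: nbhs_right_gt.
  by split; [split|]; near: e.
have e32 : e <= 3 / 2 * e by move: e0; clear; lra.
have e94 : 3 / 2 * e <= 9 / 4 * e by move: e0; clear; lra.
pose M := (3 / 2 * e) `^ (- gam^-1).
exists M; first by rewrite powR_gt0// mulr_gt0.
pose idx : seq (option 'rV[R]_N) := None :: map Some D.
pose K (i : option 'rV[R]_N) := if i is Some z then
  closure Omega `&` [set x | dot (x - z) (x - z) <= r z ^+ 2] else closure Omega.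
pose FF (i : option 'rV[R]_N) : 'rV[R]_N -> R :=
  if i is Some z then F z e else fun=> 3 / 2 * e.
pose CC (i : option 'rV[R]_N) : R := if i is Some z then C z else 0.
have KO i x : K i x -> closure Omega x by case: i => [z []|].
have FFP i x : i \in idx -> K i x ->
    [/\ e <= FF i x, FF i x <= 9 / 4 * e & continuous_at x (FF i)].
  case: i => [z|] /=; last by move=> _ _; split => //; exact: continuous_at_cst.
  rewrite inE /= => /mapP[z' zD [->]] [clx hx].
  by have [[H1 _ _ _ _] _] := HeD _ zD; exact: H1.
have CCP i : i \in idx -> 0 <= CC i /\
    L (CC i) * e `^ (- (m / gam + 2)) + a * V * e `^ (- (p / gam)) <
      b * (9 / 4) `^ (- (q / gam)) * e `^ (- (q / gam)).
  case: i => [z|] //=; rewrite inE /= => /mapP[z' zD [->]].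
  by have [_ ?] := HeD _ zD; have [_ ? _] := HD _ zD.
move=> x1 t1 clx1 t10 t1T; rewrite ltNge; apply/negP => Mu.
have sT t : t <= t1 -> (t%:E < T)%E.
  by move=> tt1; apply: le_lt_trans t1T; rewrite lee_fin.
have [||||i [x [t [iidx Kx /andP[t0 tt1] ftx before]]]] :=
  @first_contact R _ _ idx K (fun i y s => u y s - FF i y `^ (- gam^-1)) t1.
- move=> [z|] _ //=; apply: compact_closedI => //.
  apply: (@closed_comp _ _ (fun x => dot (x - z) (x - z)) [set v | v <= r z ^+ 2]).
    by move=> y _; exact: continuous_dot_sq.
  exact: closed_le.
- move=> i iidx.
  have c1 : {within K i `*` `[0, t1], continuous (fun w => u w.1 w.2)}.
    apply: continuous_subspaceW cu => -[y s] [/= /KO cly].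
    by rewrite in_itv/= => /andP[s0 st1]; split => //=; split => //; exact: sT.
  have c2 : {within K i `*` `[0, t1], continuous (fun w => FF i w.1 `^ (- gam^-1))}.
    apply/subspace_continuousP => -[y s] [/= Ky _].
    have [Fe _ cF] := FFP _ _ iidx Ky.
    have cP : continuous_at y (fun y => FF i y `^ (- gam^-1)).
      by apply: continuous_at_powR => //; exact: lt_le_trans Fe.
    apply: cvg_within_filter.
    exact: (@continuous_comp _ _ _ fst (fun y => FF i y `^ (- gam^-1)) (y, s) cvg_fst cP).
  by move=> z; exact: (cvgB (c1 z) (c2 z)).
- move=> i y iidx Ky; have [Fe F94 _] := FFP _ _ iidx Ky.
  rewrite subr_lt0; apply: le_lt_trans (HM0 _ (KO _ _ Ky)) _.
  move: Hinit; rewrite mul0r addr0 oppr0 powRr0 mulr1 => /lt_le_trans; apply.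
  rewrite -powRM ?(ltW e0)//; apply: powRN_le => //; last exact: ltW.
  exact: lt_le_trans Fe.
- exists None, x1, t1; split => //; first by rewrite t10 lexx.
  by rewrite subr_ge0.
have clx := KO _ _ Kx.
have tT := sT _ tt1.
have [Fe F94 cF] := FFP _ _ iidx Kx.
have Fx0 : 0 < FF i x by exact: lt_le_trans Fe.
have ux : u x t = FF i x `^ (- gam^-1) by apply/eqP; rewrite -subr_eq0 ftx.
have below j y : j \in idx -> K j y -> u y t <= FF j y `^ (- gam^-1).
  by move=> jj Ky; have [+ _] := before j y jj Ky; rewrite subr_le0.
have uM y : closure Omega y -> u y t <= M by move=> cly; exact: (below None).
(* [F x >= 3/2 e], since [u] is also below the constant barrier; so [x] is in the
   open ball. *)
have nK : \forall y \near x, Omega y -> K i y.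
  case: i iidx Kx ftx Fe F94 cF Fx0 ux {before below} => [z|] iidx Kx ftx Fe F94 cF Fx0 ux;
    last by near=> y; exact: subset_closure.
  have := iidx; rewrite inE /= => /mapP[z' zD [zE]]; rewrite -zE in zD.
  have [[_ H2 _ _ _] _] := HeD _ zD.
  have hF : 3 / 2 * e <= F z e x.
    apply: (@powRN_le_inv _ _ _ gam^-1) => //; last by rewrite mulr_gt0.
    by rewrite -ux; exact: uM.
  have nd : \forall y \near x, dot (y - z) (y - z) < r z ^+ 2.
    by have := continuous_dot_sq z x => /cvgr_lt; apply; exact: H2.
  near=> y => Oy; split; first exact: subset_closure.
  by apply: ltW; near: y.
have nub : \forall y \near x, Omega y -> u y t <= FF i y `^ (- gam^-1).
  by near=> y; move=> Oy; apply: below => //; move: Oy; near: y.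
(* In the interior the absorption makes the time derivative negative; on the
   boundary the constant barrier cannot be touched, because it is above the
   layer that covers [x]. *)
have [Ox|nOx] := pselect (Omega x).
- have nO : \forall y \near x, Omega y by exact: open_nbhs_nbhs.
  have dtu : 0 <= derive1 (u x) t.
    apply: derive1_ge0_left => //; first by apply: dut; split.
    move=> s /andP[s0 st]; have [_ /(_ s)] := before i x iidx Kx.
    by rewrite s0 st => /(_ isT); rewrite subr_lt0 -ux => /ltW.
  have [Ci0 HCi] := CCP _ iidx.
  have lap : laplacian (fun y => u y t `^ m) x <=
      L (CC i) * e `^ (- (m / gam + 2)).
    apply: (laplacian_contact_le Omega x (u ^~ t) (FF i)) => //.
    + by move=> y Oy; apply: upos => //; exact: ltW.
    + by move=> j y Oy; have [+ _] := dux j; apply; split.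
    + by move=> j; have [+ _] := ddux j j; apply; split.
    + move=> j; move: (iidx) (Kx); rewrite /FF /CC /K; case: (i) => [z|] zidx Kz.
        move: zidx; rewrite inE /= => /mapP[z' zD [zE]]; rewrite -zE in zD.
        have [[_ _ _ H4 _] _] := HeD _ zD.
        by apply: H4 => //; have [] := Kz.
      exists (fun=> 0), 0; split.
      * by near=> y; exact: is_derive_cst.
      * exact: is_derive_cst.
      * by rewrite expr0n.
      * by rewrite oppr0 mul0r.
    + by near=> y; have Oy : Omega y by [near: y]; move: Oy; near: y.
  have int : \int[lebesgue_rV N]_(y in Omega) (u y t `^ p) <= V * e `^ (- (p / gam)).
    apply: (le_trans (Rintegral_le_bounded _ Omega B _ (M `^ p) mB finB OB _ _)).
    + exact: powR_ge0.
    + move=> y Oy; rewrite powR_ge0/=; apply: ge0_ler_powR.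
      * exact: p0.
      * by rewrite nnegrE ltW// upos// ltW.
      * by rewrite nnegrE powR_ge0.
      * by apply: uM; exact: subset_closure.
    + have V0 : 0 <= V by rewrite fine_ge0.
      rewrite mulrC ler_wpM2l//.
      rewrite /M -powRrM (_ : - gam^-1 * p = - (p / gam)); last by rewrite mulNr mulrC.
      by apply: powRN_le.
  have uq : (9 / 4) `^ (- (q / gam)) * e `^ (- (q / gam)) <= u x t `^ q.
    rewrite ux -powRrM (_ : - gam^-1 * q = - (q / gam)); last by rewrite mulNr mulrC.
    by rewrite -powRM ?(ltW e0)//; exact: powRN_le.
  move: dtu; rewrite (pde x t Ox t0 tT) leNgt => /negP; apply.
  have gr : 0 <= c * enorm (grad (fun y => Num.sqrt (u y t)) x) ^+ 2.
    by rewrite mulr_ge0 ?(ltW c0)// sqr_ge0.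
  have ai : a * \int[lebesgue_rV N]_(y in Omega) (u y t `^ p) <=
      a * V * e `^ (- (p / gam)) by rewrite -mulrA ler_pM2l.
  have bq : b * (9 / 4) `^ (- (q / gam)) * e `^ (- (q / gam)) <= b * u x t `^ q.
    by rewrite -mulrA ler_pM2l.
  by move: lap ai bq HCi gr; clear; lra.
- have bx : boundary Omega x by split => // /interior_subset.
  move: (iidx) (Kx) (ux) Fx0 cF nub; case: (i) => [z|] zidx Kz uxz Fx0 cF nub.
    move: zidx; rewrite inE /= => /mapP[z' zD [zE]]; rewrite -zE in zD.
    have [[_ _ _ _ H5] _] := HeD _ zD.
    have [_ hx] := Kz.
    have [nu [dF [nuO inO dFn cdF dFx]]] := H5 x bx hx.
    apply: (boundary_contact_absurd Omega x nu (u ^~ t) (Du ^~ t) (F z e) dF gam k) => //.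
    + exact: cut (ltW t0) tT.
    + apply: (continuous_within_comp _ _ (fun y => (y, t)) _ cDu) => //.
        exact: continuous_pairr.
      by move=> y cly; split => //=; split => //; exact: ltW.
    + by move=> y Oy j; apply: du => //; exact: ltW.
    + rewrite (bc x nu t bx nuO (ltW t0) tT).
      have := hg (u x t); rewrite uxz powR_ge0 => /(_ isT).
      by rewrite /gam addrAC.
  have [z zD hx] := covD x bx.
  have [[_ _ H3 _ _] _] := HeD _ zD.
  have := H3 x bx hx => Fz.
  have zidx' : Some z \in idx by rewrite inE /= map_f.
  have Kz' : K (Some z) x.
    split; first exact: clx.
    apply: (le_trans (ltW hx)); rewrite ler_pdivrMr// ler_peMr ?sqr_ge0//.
    by rewrite ler1n.
  have := below _ _ zidx' Kz'; rewrite uxz leNgt => /negP; apply.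
  by apply: powRN_lt => //=; rewrite mulr_gt0.
Unshelve. all: by end_near. Qed.

End bound.

Theorem theorem3p3 (R : realType) (N : nat) (hN : (1 <= N)%N)
    (Omega : set 'rV[R]_N) (hOmega : assumption_A Omega)
    (a b c k : R) (ha : 0 < a) (hb : 0 < b) (hc : 0 < c) (hk : 0 < k)
    (m p q : R) (hm : 1 < m) (hmp : m < p) (hpq : p < q)
    (h2p : 2 * p < m + q)
    (g : R -> R) (hg_smooth : C1_halfline g)
    (hg : forall xi : R, 0 <= xi -> 0 <= g xi <= k * xi `^ (p - m + 1))
    (alpha : R) (halpha : 0 < alpha < 1)
    (u0 : 'rV[R]_N -> R) (hu0_pos : forall x, Omega x -> 0 < u0 x)
    (hu0_C2 : C2_holder alpha Omega u0)
    (Du0 : 'rV[R]_N -> 'rV[R]_N) (hu0_C1 : C1_closure Omega u0 Du0)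
    (hu0_bc : forall x nu, boundary Omega x -> outward_unit_normal Omega x nu ->
       dot (Du0 x) nu = g (u0 x))
    (tstar : \bar R) (u : 'rV[R]_N -> R -> R)
    (hu : classical_solution Omega a b c m p q g u0 tstar u)
    (hmax : maximal_time Omega tstar u) :
  tstar = +oo%E.
Proof.
have [[oO _ bO sO] _ _ _] := hOmega.
case: hmax => [//|[t0 tt0 blowup]].
have hg' xi : 0 <= xi -> g xi <= k * xi `^ (p - m + 1) by move=> /hg/andP[].
have [M M0 uM] := sup_bound _ _ _ _ _ _ _ _ _ _ _ _ oO bO sO ha hb hc hk hm hmp
  hpq h2p hg' hu.
have [T0 upos _ _ _] := hu.
have t0_gt0 : 0 < t0 by rewrite -lte_fin -tt0.
move: blowup => /cvgeyPgt/(_ M) blowup.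
have [t [[t_ge0 ltt0]]] : exists t, (0 < t /\ t < t0) /\
    (M%:E < Linfty_norm Omega (u ^~ t))%E.
  have : \forall t \near t0^'-, (0 < t /\ t < t0) /\
      (M%:E < Linfty_norm Omega (u ^~ t))%E.
    near=> t; split; last by near: t.
    by split; near: t; [exact: nbhs_left_gt|exact: nbhs_left_lt].
  by move=> /filter_ex.
rewrite ltNge => /negP; case; apply: Linfty_norm_le => [|x Ox]; first exact: ltW.
have tT : (t%:E < tstar)%E by rewrite tt0 lte_fin.
rewrite gtr0_norm ?upos ?(ltW t_ge0)//.
by apply/ltW/uM => //; [exact: subset_closure|exact: ltW].
Unshelve. all: by end_near. Qed.
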